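(* Let $K\subset\mathbb{R}^n$ be a convex body and let $P=\sum_{j=1}^n[0,z_j]$ be a lattice parallelepiped, where $z_1,\dots,z_n\in\mathbb{Z}^n$ are linearly independent. Then \[\mathrm{G}(K)\leq\sum_{i=0}^n\ \sum_{J\in\binom{[n]}{i}}\operatorname{vol}_{n-i}(K|L_J^\perp)\,\operatorname{vol}_i(P_J),\] where $L_J=\operatorname{lin}\{z_j:j\in J\}$ and $P_J=\sum_{j\in J}[0,z_j]$ for each $J\in\binom{[n]}{i}$. Equality holds if and only if $P$ is a fundamental cell of $\mathbb{Z}^n$ and $K\in\mathcal{Q}(P)$.
   Context: A convex body in $\mathbb{R}^n$ is a compact convex set with nonempty interior. For a bounded set $S\subset\mathbb{R}^n$, $\mathrm{G}(S)=\#(S\cap\mathbb{Z}^n)$. $\operatorname{vol}_i$ is $i$-dimensional Lebesgue measure (volume within the relevant $i$-dimensional linear subspace), with $\operatorname{vol}_0$ of a single point equal to $1$. $[0,z]$ is the segment from $0$ to $z$, and sums of sets are Minkowski sums (the empty sum being $\{0\}$). $\operatorname{lin}$ denotes linear hull (with $\operatorname{lin}\emptyset=\{0\}$), $L^\perp$ is the orthogonal complement of $L$, and $K|L$ is the orthogonal projection of $K$ onto the linear subspace $L$. $\binom{[n]}{i}$ is the set of all $i$-element subsets of $[n]=\{1,\dots,n\}$. A lattice polytope (in particular, a lattice parallelepiped) is one all of whose vertices lie in $\mathbb{Z}^n$. $\mathcal{Q}(P)$ is the set of all $n$-dimensional lattice parallelepipeds in $\mathbb{R}^n$ whose edges are parallel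 to those of $P$. $P$ is a fundamental cell of $\mathbb{Z}^n$ if $z_1,\dots,z_n$ form a lattice basis of $\mathbb{Z}^n$. *)

(* Defs.v *)
From HB Require Import structures.
From mathcomp Require Import all_boot all_order all_algebra.
From mathcomp Require Import all_classical all_reals all_analysis.
From mathcomp Require Import zify.

Set Implicit Arguments.
Unset Strict Implicit.
Unset Printing Implicit Defensive.

Import Order.TTheory GRing.Theory Num.Theory numFieldNormedType.Exports.

Local Open Scope classical_set_scope.
Local Open Scope ring_scope.

(* Lebesgue measure on the Borel sets of R^n, with R^n represented by tuples:
   the image of the n-fold product measure. For n = 0 it is the unit mass at
   the only point. *)
Fixpoint lebesgue_tuple (R : realType) (n : nat) :
    set (n.-tuple (measurableTypeR R)) -> \bar R :=
  match n with
  | 0 => \d_([tuple] : 0.-tuple (measurableTypeR R))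
  | m.+1 =>
      pushforward (lebesgue_measure \x @lebesgue_tuple R m)%E
        (fun p : measurableTypeR R * m.-tuple (measurableTypeR R) =>
           [tuple of p.1 :: p.2])
  end.

Section lebesgue_tuple_measure.
Context {R : realType}.
Local Notation T := (measurableTypeR R).

Lemma measurable_tuple_cons (m : nat) :
  measurable_fun [set: T * m.-tuple T]
    (fun p : T * m.-tuple T => [tuple of p.1 :: p.2] : m.+1.-tuple T).
Proof. by apply: measurable_cons. Qed.

Lemma measurable_tuple_uncons (m : nat) :
  measurable_fun [set: m.+1.-tuple T]
    (fun t : m.+1.-tuple T => (thead t, [tuple of behead t] : m.-tuple T)).
Proof.
apply/measurable_fun_pairP; split; last exact: measurable_behead.
exact: measurable_tnth.
Qed.

Lemma lebesgue_tuple_sigma_finite_measure (n : nat) :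
  exists mu : {sigma_finite_measure set (n.-tuple T) -> \bar R},
    @lebesgue_tuple R n = mu.
Proof.
elim: n => [|n [mu muE]].
  by exists \d_([tuple] : 0.-tuple T).
pose f (p : T * n.-tuple T) : n.+1.-tuple T := [tuple of p.1 :: p.2].
pose g (t : n.+1.-tuple T) : T * n.-tuple T := (thead t, [tuple of behead t]).
have mf : measurable_fun setT f by exact: measurable_tuple_cons.
have mg : measurable_fun setT g by exact: measurable_tuple_uncons.
have fK : cancel f g.
  by move=> [x t]; rewrite /f /g theadE; congr pair; exact: val_inj.
pose m := (@lebesgue_measure R \x mu)%E.
have /sigma_finiteP[F [FT ndF Foo]] := sigma_finiteT (@lebesgue_measure R).
have /sigma_finiteP[G [GT ndG Goo]] := sigma_finiteT mu.
have sf : sigma_finite setT (pushforward m f).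
  exists (fun k => g @^-1` (F k `*` G k)).
    apply/esym; rewrite -subTset => t _; rewrite -preimage_bigcup /preimage/=.
    have : [set: T] (g t).1 by [].
    rewrite FT => -[i _ Fi].
    have : [set: n.-tuple T] (g t).2 by [].
    rewrite GT => -[j _ Gj].
    exists (maxn i j) => //; split.
      by move: Fi; exact/subsetPset/ndF/leq_maxl.
    by move: Gj; exact/subsetPset/ndG/leq_maxr.
  move=> k; have [mFk Fkoo] := Foo k; have [mGk Gkoo] := Goo k; split.
    by rewrite -[X in measurable X]setTI; apply: mg => //; exact: measurableX.
  rewrite /pushforward -comp_preimage (_ : g \o f = id) ?preimage_id; last first.
    by apply/funext => x /=; rewrite fK.
  by rewrite /m product_measure1E// lte_mul_pinfty// ge0_fin_numE.
pose nu : {measure set (n.+1.-tuple T) -> \bar R} :=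
  measure_function_pushforward__canonical__measure_function_Measure
    (@lebesgue_measure R \x mu)%E mf.
pose nuS := @Measure_isSigmaFinite.Build _ _ _ nu sf.
pose nu' : {sigma_finite_measure set (n.+1.-tuple T) -> \bar R} :=
  HB.pack (pushforward m f) (Measure.class nu) nuS.
by exists (nu' mf); rewrite /= muE.
Qed.

End lebesgue_tuple_measure.

Section convex_geometry.
Context {R : realType} {n : nat}.
Local Notation V := 'rV[R]_n.

Definition convex_body (K : set V) : Prop :=
  [/\ compact K, convex_set (K : set (convex_lmodType V)) & interior K !=set0].

Definition integer_lattice : set V :=
  [set map_mx (fun a : int => a%:~R) z | z in [set: 'rV[int]_n]].

Definition lattice_count (S : set V) : \bar R :=
  counting (S `&` integer_lattice).

Definition segment (a b : V) : set V :=
  [set (1 - t) *: a + t *: b | t in `[0, 1]].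

Definition minkowski_sum (A B : set V) : set V :=
  [set a + b | a in A & b in B].

Definition segment_sum (I : finType) (J : {set I}) (z : I -> V) : set V :=
  \big[minkowski_sum/[set 0]]_(j in J) segment 0 (z j).

(* Linear subspaces of R^n are represented by matrices, as their row spaces. *)

Definition lin_hull (I : finType) (J : {set I}) (z : I -> V) : 'M[R]_n :=
  (\sum_(j in J) <<z j>>)%MS.

Definition orth_compl (L : 'M[R]_n) : 'M[R]_n := kermx L^T.

Definition orth_proj (L : 'M[R]_n) (K : set V) : set V :=
  [set y | (y <= L)%MS /\ exists2 x, K x & (x - y <= orth_compl L)%MS].

Definition orthonormal_basis (k : nat) (L : 'M[R]_n) (B : 'M[R]_(k, n)) : Prop :=
  B *m B^T = 1%:M /\ (B :=: L)%MS.

Lemma gram_schmidt (k : nat) (A : 'M[R]_(k, n)) : row_free A ->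
  exists2 B : 'M[R]_(k, n), B *m B^T = 1%:M & (B :=: A)%MS.
Proof.
suff: row_free A ->
    exists2 B : 'M[R]_(k, n), B *m B^T = 1%:M & (B <= A)%MS.
  move=> H fA; have [B BB1 BA] := H fA; exists B => //.
  have rB : \rank B = k.
    apply/eqP; rewrite eqn_leq rank_leq_row/=.
    by rewrite -[leqLHS](mxrank1 R) -BB1 mxrankM_maxl.
  apply/eqmxP; rewrite -(geq_leqif (mxrank_leqif_eq BA)) rB.
  exact: rank_leq_row.
elim: k A => [|k IH] A fA.
  by exists 0; rewrite ?sub0mx//; apply/matrixP => -[].
pose a : 'rV[R]_n := @usubmx _ 1 k n A; pose A' : 'M[R]_(k, n) := @dsubmx _ 1 k n A.
have AE : A = col_mx a A' by rewrite (@vsubmxK _ 1 k).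
have fA' : row_free A'.
  have rA : \rank A = \rank (a + A')%MS.
    by rewrite AE; apply/esym/eqmx_rank/eqmxP/addsmxE.
  move: fA; rewrite /row_free !eqn_leq !rank_leq_row/= {}rA => rA.
  have [+ _] := mxrank_adds_leqif a A'.
  by have := rank_leq_row a; move: rA; lia.
have [B BB1 BA'] := IH _ fA'.
pose v := a - a *m B^T *m B.
have vB : v *m B^T = 0 by rewrite mulmxBl -!mulmxA BB1 mulmx1 subrr.
have Bv : B *m v^T = 0 by rewrite -[B]trmxK -trmx_mul vB trmx0.
have vn0 : v != 0.
  apply/eqP => v0.
  have aA' : (a <= A')%MS.
    by rewrite (_ : a = a *m B^T *m B) ?mulmx_sub//; apply/eqP; rewrite -subr_eq0 -/v v0.
  move: fA; rewrite /row_free AE => /eqP rA.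
  have : (col_mx a A' <= A')%MS by rewrite col_mx_sub aA' submx_refl.
  by move=> /mxrankS; rewrite rA => /leq_trans /(_ (rank_leq_row _)); rewrite ltnn.
pose c := (v *m v^T) 0 0.
have cE : c = \sum_j v 0 j ^+ 2.
  by rewrite /c [LHS]mxE; apply: eq_bigr => j _; rewrite [v^T _ _]mxE expr2.
have c0 : 0 < c.
  rewrite lt_neqAle cE sumr_ge0 ?andbT; last by move=> j _; exact: sqr_ge0.
  apply: contra vn0 => /eqP/esym s0; apply/eqP/rowP => j; rewrite [RHS]mxE.
  apply/eqP; rewrite -sqrf_eq0; apply/eqP.
  by apply: (psumr_eq0P _ s0) => // i _; exact: sqr_ge0.
pose u := (Num.sqrt c)^-1 *: v.
have uBT : u *m B^T = 0 by rewrite -scalemxAl vB scaler0.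
have BuT : B *m u^T = 0 by rewrite linearZ/= -scalemxAr Bv scaler0.
have uuT : u *m u^T = 1%:M.
  rewrite linearZ/= -scalemxAl -scalemxAr scalerA -invfM -expr2.
  rewrite sqr_sqrtr ?ltW// [v *m _]mx11_scalar -/c scale_scalar_mx.
  by rewrite mulVf ?gt_eqF.
exists (col_mx u B : 'M[R]_(1 + k, n)).
  transitivity (col_mx u B *m (col_mx u B)^T); first by [].
  by rewrite tr_col_mx mul_col_row BB1 uBT BuT uuT -scalar_mx_block.
have : (col_mx a A' <= A)%MS by rewrite AE.
rewrite col_mx_sub => /andP[aA A'A].
have BA : (B <= A)%MS := submx_trans BA' A'A.
by rewrite (@col_mx_sub _ 1 k) BA andbT scalemx_sub// addmx_sub// -mulNmx mulmx_sub.
Qed.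

Lemma orthonormal_basis_exists (L : 'M[R]_n) :
  exists B : 'M[R]_(\rank L, n), orthonormal_basis L B.
Proof.
have [B BB1 BL] := gram_schmidt (row_base_free L).
by exists B; split=> //; exact: eqmx_trans BL (eq_row_base L).
Qed.

(* The k-dimensional Lebesgue measure of S within the linear subspace L, for
   k = \rank L, measured in the coordinates of an orthonormal basis of L. *)
Definition vol (k : nat) (L : 'M[R]_n) (S : set V) : \bar R :=
  let B := xget 0 [set B : 'M[R]_(k, n) | orthonormal_basis L B] in
  lebesgue_tuple
    [set t : k.-tuple (measurableTypeR R) | S ((\row_i tnth t i) *m B)].

Definition lattice_basis (z : 'I_n -> V) : Prop :=
  row_free (\matrix_j z j) /\
  integer_lattice = [set \sum_j z j *~ c j | c in [set: 'I_n -> int]].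

Definition face (S F : set V) : Prop :=
  [/\ F `<=` S, convex_set (F : set (convex_lmodType V)) &
    forall (x y : V) (t : R), S x -> S y -> 0 < t < 1 ->
      F ((1 - t) *: x + t *: y) -> F x /\ F y].

Definition vertex (S : set V) (v : V) : Prop := face S [set v].

Definition edge (S : set V) (a b : V) : Prop :=
  a != b /\ face S (segment a b).

Definition parallelepiped (Q : set V) : Prop :=
  exists (v : V) (w : 'I_n -> V),
    row_free (\matrix_j w j) /\
    Q = minkowski_sum [set v] (segment_sum [set: 'I_n]%SET w).

(* The class Q(P); nonzero vectors are parallel when they are proportional. *)
Definition lattice_parallelepipeds_along (P : set V) : set (set V) :=
  [set Q | [/\ parallelepiped Q, vertex Q `<=` integer_lattice &
    forall a b, edge Q a b ->
      exists c d, edge P c d /\ exists r : R, b - a = r *: (d - c)]].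

End convex_geometry.

(* Main.v *)
Require Import Defs.
From mathcomp Require Import all_boot all_order all_algebra.
From mathcomp Require Import all_classical all_reals all_analysis.
From mathcomp Require Import fingroup perm measurable_realfun finmap zify ring lra.

(** Let [Z] be the matrix with rows [z j], let [K'] be [K] in the coordinates given
    by the basis [z], and let [C] be the unit cube.

    The bound is the volume of [K + P], that is [|det Z| * vol (K' + C)]. Adding a
    unit segment in one coordinate direction to a compact convex body increases the
    length of every nonempty slice in that direction by 1, hence the volume by the
    volume of the shadow along that direction ([leb_thicken]). Doing this for all
    directions expands [vol (K' + C)] into a sum over the sets [J] of directions
    ([leb_cube_sum_slabs]); a linear change of variables ([unitmx_scales_leb])
    identifies the summand of [J] with the product of volumes in the bound
    ([bound_term]).

    For the inequality, [Z^n] is the union of [|det Z|] cosets of the lattice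
    spanned by the [z j] ([coset_representatives]). In the coordinates of [z] a
    coset is a translate of [Z^n], and the half-open unit cells at its points in
    [K'] are disjoint and contained in [K' + C]; so it has at most [vol (K' + C)]
    points in [K] ([counting_le_leb]).

    In case of equality the cells at the points of each single coset fill
    [K' + C] up to a set without interior. A convex body filled by unit cells is a
    box: pushing the cell of one point towards another point makes it cross a
    facet, and the cell behind the facet must be present ([tight_step]). So [K'] is
    a box whose corners belong to the coset ([tight_int_box]); as this holds for
    all cosets, there is only one, and the [z j] form a lattice basis
    ([equality_coord]). Conversely, a box with integer corners is covered by as
    many closed cells as it has lattice points ([int_box_points]).

    Finally, when the [z j] form a lattice basis, [K'] is such a box if and only if
    [K] belongs to [Q(P)]. This needs the vertices and edges of a parallelepiped
    in the sense of faces ([vertex_para], [edge_para], [para_vertex], [para_edge]),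
    and the fact that edges parallel to those of [P] with lattice points as ends are
    integer multiples of the [z j] ([class_int_box], [int_box_in_class]). *)

Set Implicit Arguments.
Unset Strict Implicit.
Unset Printing Implicit Defensive.

Import Order.TTheory GRing.Theory Num.Theory numFieldNormedType.Exports.

Local Open Scope classical_set_scope.
Local Open Scope ring_scope.

(** * Lebesgue measure on row vectors *)

Section row_measure.
Context {R : realType}.
Local Notation T := (measurableTypeR R).

Definition tuple_of_row_set (n : nat) (S : set 'rV[R]_n) : set (n.-tuple T) :=
  [set t | S (\row_i tnth t i)].

Definition row_measurable (n : nat) (S : set 'rV[R]_n) : Prop :=
  measurable (tuple_of_row_set S).

Definition leb (n : nat) (S : set 'rV[R]_n) : \bar R :=
  @lebesgue_tuple R n (tuple_of_row_set S).

Lemma row_measurableE n (S : set 'rV[R]_n) :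
  row_measurable S = measurable (tuple_of_row_set S).
Proof. by []. Qed.

Lemma leb_ge0 n (S : set 'rV[R]_n) : (0 <= leb S)%E.
Proof. by rewrite /leb; have [mu ->] := @lebesgue_tuple_sigma_finite_measure R n. Qed.

Lemma le_leb n (S U : set 'rV[R]_n) : row_measurable S -> row_measurable U ->
  S `<=` U -> (leb S <= leb U)%E.
Proof.
rewrite /leb => mS mU SU; have [mu ->] := @lebesgue_tuple_sigma_finite_measure R n.
by apply: le_measure => [||t]; [exact: mem_set|exact: mem_set|exact: SU].
Qed.

Lemma row_measurableU n (S U : set 'rV[R]_n) : row_measurable S ->
  row_measurable U -> row_measurable (S `|` U).
Proof. exact: measurableU. Qed.

Lemma row_measurableI n (S U : set 'rV[R]_n) : row_measurable S ->
  row_measurable U -> row_measurable (S `&` U).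
Proof. exact: measurableI. Qed.

Lemma row_measurable0 n : row_measurable (@set0 'rV[R]_n).
Proof. exact: measurable0. Qed.

Lemma lebU n (S U : set 'rV[R]_n) : row_measurable S -> row_measurable U ->
  S `&` U = set0 -> leb (S `|` U) = (leb S + leb U)%E.
Proof.
move=> mS mU SU; rewrite /leb.
have [mu ->] := @lebesgue_tuple_sigma_finite_measure R n.
rewrite (_ : tuple_of_row_set (S `|` U) = tuple_of_row_set S `|` tuple_of_row_set U)//.
rewrite measureU//; apply/seteqP; split=> // t [St Ut].
by have : (S `&` U) (\row_i tnth t i) by []; rewrite SU.
Qed.

Lemma lebU_le n (S U : set 'rV[R]_n) : row_measurable S -> row_measurable U ->
  (leb (S `|` U) <= leb S + leb U)%E.
Proof.
move=> mS mU; rewrite /leb.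
have [mu ->] := @lebesgue_tuple_sigma_finite_measure R n.
exact: measureU2.
Qed.

Lemma leb0 n : leb (@set0 'rV[R]_n) = 0%E.
Proof.
rewrite /leb; have [mu ->] := @lebesgue_tuple_sigma_finite_measure R n.
exact: measure0.
Qed.

Lemma bigcup_cons (U : Type) (I : choiceType) (F : I -> set U) (i : I) (s : seq I) :
  \bigcup_(j in [set` i :: s]) F j = F i `|` \bigcup_(j in [set` s]) F j.
Proof. by rewrite !bigcup_seq big_cons. Qed.

Section finite_unions.
Variables (n : nat) (I : choiceType) (F : I -> set 'rV[R]_n).
Hypothesis mF : forall i, row_measurable (F i).

Lemma row_measurable_bigcup (s : seq I) :
  row_measurable (\bigcup_(i in [set` s]) F i).
Proof.
elim: s => [|i s IH]; first by rewrite bigcup_seq big_nil; exact: row_measurable0.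
by rewrite bigcup_cons; exact: row_measurableU.
Qed.

Lemma leb_bigcup (s : seq I) : uniq s -> trivIset [set` s] F ->
  leb (\bigcup_(i in [set` s]) F i) = (\sum_(i <- s) leb (F i))%E.
Proof.
elim: s => [|i s IH]; first by rewrite bigcup_seq !big_nil leb0.
move=> /= /andP[ins us] tF.
rewrite bigcup_cons big_cons lebU//; last 2 first.
- exact: row_measurable_bigcup.
- rewrite setI_bigcupr bigcup0// => j /= js.
  apply/eqP; apply: contraT => /set0P ij.
  suff ij' : i = j by move: ins; rewrite ij' js.
  by apply: tF => //; rewrite /= in_cons ?eqxx// js orbT.
rewrite IH// => j k js ks; apply: tF; by rewrite /= in_cons ?(js : _ \in s) ?(ks : _ \in s) orbT.
Qed.

Lemma leb_bigcup_le (s : seq I) :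
  (leb (\bigcup_(i in [set` s]) F i) <= \sum_(i <- s) leb (F i))%E.
Proof.
elim: s => [|i s IH]; first by rewrite bigcup_seq !big_nil leb0.
rewrite bigcup_cons big_cons.
apply: le_trans (lebU_le _ _) _ => //; first exact: row_measurable_bigcup.
by rewrite leeD2l.
Qed.

End finite_unions.

End row_measure.

(** * Slicing along the first coordinate *)

Section fubini.
Context {R : realType}.
Local Notation T := (measurableTypeR R).
Local Notation mu1 := (@lebesgue_measure R).

Definition cons_row n (x : R) (y : 'rV[R]_n) : 'rV[R]_n.+1 := row_mx (x%:M : 'M[R]_1) y.

Lemma cons_row0 n x (y : 'rV[R]_n) : cons_row x y 0 0 = x.
Proof.
rewrite mxE; case: splitP => [j _|//].
by rewrite ord1 mxE.
Qed.

Lemma cons_rowS n x (y : 'rV[R]_n) i : cons_row x y 0 (lift 0 i) = y 0 i.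
Proof.
rewrite mxE; case: splitP => [[[|//] ?]//|j] /=.
by rewrite /bump/= !add1n => -[ij]; congr (y _ _); exact: val_inj.
Qed.

Lemma row_of_cons n (x : T) (t : n.-tuple T) :
  (\row_i tnth [tuple of x :: t] i : 'rV[R]_n.+1) = cons_row x (\row_i tnth t i).
Proof.
apply/rowP => i; rewrite mxE; have [j ->|->] := unliftP ord0 i.
  by rewrite cons_rowS mxE tnthS.
by rewrite cons_row0.
Qed.

Lemma cons_rowP n (v : 'rV[R]_n.+1) : exists x y, v = cons_row x y.
Proof.
exists (v 0 0), (\row_i v 0 (lift 0 i)); apply/rowP => i.
have [j ->|->] := unliftP ord0 i; first by rewrite cons_rowS mxE.
by rewrite cons_row0.
Qed.

Definition pair_set n (S : set 'rV[R]_n.+1) : set (T * n.-tuple T) :=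
  [set p | S (cons_row p.1 (\row_i tnth p.2 i))].

Lemma measurable_pair_set n (S : set 'rV[R]_n.+1) :
  row_measurable S -> measurable (pair_set S).
Proof.
move=> mS; have := @measurable_tuple_cons R n measurableT _ mS; rewrite setTI.
by congr measurable; apply/funext => -[x t]; rewrite /preimage/tuple_of_row_set/= row_of_cons.
Qed.

(** The two orders of integration: with the first coordinate outermost the slices
    are lower dimensional bodies, with it innermost they are subsets of the line. *)
Lemma lebE1 n (S : set 'rV[R]_n.+1) :
  leb S = (\int[mu1]_x leb [set y | S (cons_row x y)])%E.
Proof.
rewrite /leb/= /pushforward/= /product_measure1; apply: eq_integral => x _ /=.
congr lebesgue_tuple; apply/funext => t; apply/propext.
by rewrite xsectionE/= /tuple_of_row_set/= row_of_cons.
Qed.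

Lemma lebE2 n (S : set 'rV[R]_n.+1) : row_measurable S ->
  leb S = (\int[@lebesgue_tuple R n]_t
    mu1 [set x | S (cons_row x (\row_i tnth t i))])%E.
Proof.
move=> /measurable_pair_set mS.
have [mu muE] := @lebesgue_tuple_sigma_finite_measure R n.
have -> : leb S = (mu1 \x mu)%E (pair_set S).
  rewrite /leb/= /pushforward/= muE; congr (_ _).
  by apply/funext => -[x t]; rewrite /= /tuple_of_row_set/= row_of_cons.
rewrite (@product_measure_unique _ _ _ _ _ mu1 mu
  (mu1 \x^ mu)%E _ _ mS); last by move=> A B mA mB; exact: product_measure2E.
rewrite muE /= /product_measure2; apply: eq_integral => t _ /=.
congr lebesgue_measure; apply/funext => x; apply/propext.
by rewrite ysectionE.
Qed.

Lemma row_measurable_section n (S : set 'rV[R]_n.+1) x : row_measurable S ->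
  row_measurable [set y | S (cons_row x y)].
Proof.
move=> /measurable_pair_set mS; have := @measurable_xsection _ _ _ _ _ x mS.
congr measurable; apply/funext => t; apply/propext.
by rewrite xsectionE.
Qed.

Lemma measurable_section n (S : set 'rV[R]_n.+1) (y : 'rV[R]_n) : row_measurable S ->
  measurable ([set x | S (cons_row x y)] : set T).
Proof.
move=> /measurable_pair_set mS.
have := @measurable_ysection _ _ _ _ _ [tuple y 0 i | i < n] mS.
congr measurable; apply/funext => x; apply/propext.
rewrite ysectionE /pair_set/=.
by have -> : \row_i tnth [tuple y 0 i0  | i0 < n] i = y by
  apply/rowP => i; rewrite mxE tnth_mktuple.
Qed.

Lemma measurable_fun_section1 n (S : set 'rV[R]_n.+1) : row_measurable S ->
  measurable_fun [set: T] ((fun x => leb [set y | S (cons_row x y)]) : T -> \bar R).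
Proof.
move=> /measurable_pair_set mS.
have [mu muE] := @lebesgue_tuple_sigma_finite_measure R n.
have := measurable_fun_xsection mu mS.
congr (measurable_fun _ _); apply/funext => x /=; rewrite /leb muE.
congr (mu _); apply/funext => t; apply/propext.
by rewrite xsectionE.
Qed.

Lemma measurable_fun_section2 n (S : set 'rV[R]_n.+1) : row_measurable S ->
  measurable_fun [set: n.-tuple T]
   ((fun t => mu1 [set x | S (cons_row x (\row_i tnth t i))]) : n.-tuple T -> \bar R).
Proof.
move=> /measurable_pair_set mS.
have := measurable_fun_ysection mu1 mS.
congr (measurable_fun _ _); apply/funext => x /=.
congr (mu1 _); apply/funext => t; apply/propext.
by rewrite ysectionE.
Qed.

Lemma leb_scale_sections1 n (S U : set 'rV[R]_n.+1) (c : R) : 0 <= c ->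
  row_measurable U ->
  (forall x, leb [set y | S (cons_row x y)] = c%:E * leb [set y | U (cons_row x y)])%E ->
  (leb S = c%:E * leb U)%E.
Proof.
move=> c0 mU E; rewrite !lebE1 (eq_integral (fun x : T => c%:E *
  leb [set y | U (cons_row x y)])%E); last by move=> x _; exact: E.
rewrite ge0_integralZl//; first exact: measurable_fun_section1.
by move=> x _; exact: leb_ge0.
Qed.

Lemma leb_scale_sections2 n (S U : set 'rV[R]_n.+1) (c : R) : 0 <= c ->
  row_measurable S -> row_measurable U ->
  (forall y, mu1 [set x | S (cons_row x y)] = c%:E * mu1 [set x | U (cons_row x y)])%E ->
  (leb S = c%:E * leb U)%E.
Proof.
move=> c0 mS mU E; rewrite !lebE2//.
have [mu ->] := @lebesgue_tuple_sigma_finite_measure R n.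
rewrite -ge0_integralZl//; last exact: measurable_fun_section2.
by apply: eq_integral => t _; exact: E.
Qed.

Lemma leb_add_sections2 n (S U W : set 'rV[R]_n.+1) :
  row_measurable S -> row_measurable U -> row_measurable W ->
  (forall y, mu1 [set x | S (cons_row x y)] =
    mu1 [set x | U (cons_row x y)] + mu1 [set x | W (cons_row x y)])%E ->
  (leb S = leb U + leb W)%E.
Proof.
move=> mS mU mW E; rewrite !lebE2//.
have [mu muE] := @lebesgue_tuple_sigma_finite_measure R n.
rewrite !muE -ge0_integralD//; [|exact: measurable_fun_section2..].
by apply: eq_integral => t _; exact: E.
Qed.

Lemma lebesgue_measure_affine (a b : R) (A : set T) : a != 0 -> measurable A ->
  (mu1 A = `|a|%:E * mu1 [set x | A ((a * x + b)%R)])%E.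
Proof.
move=> a0 mA.
pose f (x : T) : T := a * x + b.
have mf : measurable_fun setT f.
  by apply: measurable_funD => //; apply: measurable_funM.
pose nu : {measure set T -> \bar R} :=
  mscale (NngNum (normr_ge0 a)) (measure_function_pushforward__canonical__measure_function_Measure mu1 mf).
rewrite (@lebesgue_measure_unique R nu)// => _ [[u v] _ <-] /=.
rewrite /nu/= /mscale/= /pushforward/=.
have E : f @^-1` `]u, v] = if 0 < a then `]((u - b) / a), ((v - b) / a)]%classic
   else `[((v - b) / a), ((u - b) / a)[%classic.
  apply/funext => x; apply/propext; rewrite /f/=; case: ltP => ha.
    rewrite /= !in_itv/= ltr_pdivrMr// ler_pdivlMr// ltrBlDr lerBrDr.
    by rewrite mulrC.
  have {}ha : a < 0 by rewrite lt_neqAle a0.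
  rewrite /= !in_itv/= ler_ndivrMr// ltr_ndivlMr// lerBrDr ltrBlDr.
  by rewrite andbC mulrC.
rewrite E; case: ltP => ha; rewrite !lebesgue_measure_itv/= !lte_fin.
  rewrite ltr_pM2r ?invr_gt0// ltrD2r gtr0_norm//.
  case: ifP => uv; last by rewrite mule0.
  by rewrite -!EFinB -EFinM; congr (_%:E); field.
have {}ha : a < 0 by rewrite lt_neqAle a0.
rewrite ltr_nM2r ?invr_lt0// ltrD2r ltr0_norm//.
case: ifP => uv; last by rewrite mule0.
by rewrite -!EFinB -EFinM; congr (_%:E); field.
Qed.

End fubini.

(** * Linear changes of variables *)

Section change_of_variables.
Context {R : realType}.
Local Notation T := (measurableTypeR R).
Local Notation mu1 := (@lebesgue_measure R).

Lemma row_measurable_affine m n (S : set 'rV[R]_n) (A : 'M[R]_(m, n)) b :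
  row_measurable S -> row_measurable [set x | S (x *m A + b)].
Proof.
move=> mS.
pose f (t : m.-tuple T) : n.-tuple T :=
  [tuple \sum_i tnth t i * A i j + b 0 j | j < n].
have mf : measurable_fun setT f.
  apply/measurable_fun_tnthP => j.
  rewrite (_ : _ \o _ = fun t : m.-tuple T => \sum_i tnth t i * A i j + b 0 j).
    apply: measurable_funD => //; apply: measurable_sum => i.
    apply: measurable_funM => //; exact: measurable_tnth.
  by apply/funext => t /=; rewrite tnth_mktuple.
have := mf measurableT _ mS; rewrite setTI; congr measurable.
apply/funext => t; rewrite /tuple_of_row_set /preimage/=; congr S.
apply/rowP => j; rewrite !mxE tnth_mktuple; congr (_ + _).
by apply: eq_bigr => i _; rewrite mxE.
Qed.

Lemma row_measurable_mul m n (S : set 'rV[R]_n) (A : 'M[R]_(m, n)) :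
  row_measurable S -> row_measurable [set x | S (x *m A)].
Proof.
move=> /(row_measurable_affine A 0); congr row_measurable.
by apply/funext => x /=; rewrite addr0.
Qed.

Lemma row_measurable_translate n (S : set 'rV[R]_n) b :
  row_measurable S -> row_measurable [set x | S (x + b)].
Proof.
move=> /(row_measurable_affine 1%:M b); congr row_measurable.
by apply/funext => x /=; rewrite mulmx1.
Qed.

Lemma cons_rowD n x u (y v : 'rV[R]_n) :
  cons_row x y + cons_row u v = cons_row (x + u) (y + v).
Proof. by rewrite /cons_row (@add_row_mx _ 1 1 n) -raddfD. Qed.

Lemma leb_translate n (S : set 'rV[R]_n) b :
  row_measurable S -> leb [set x | S (x + b)] = leb S.
Proof.
elim: n S b => [|n IH] S b mS.
  by congr leb; apply/funext => x /=; rewrite [x + b]thinmx0 [x]thinmx0.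
have [b0 [b' ->]] := cons_rowP b.
have mS0 := row_measurable_translate (cons_row b0 0) mS.
rewrite -[RHS]mul1e -[X in (_ * X)%E]mul1e.
transitivity (1 * leb [set x : 'rV[R]_n.+1 | S (x + cons_row b0 0)%R])%E; last first.
  congr (_ * _)%E; apply: (leb_scale_sections2 ler01) => // y.
  rewrite (@lebesgue_measure_affine _ 1 b0 _ (oner_neq0 _) (measurable_section y mS)).
  rewrite normr1 !mul1e; congr (mu1 _).
  by apply/funext => x /=; rewrite cons_rowD addr0 mul1r.
apply: (leb_scale_sections1 ler01) => // x; rewrite mul1e.
rewrite -(IH _ b' (row_measurable_section x mS0)).
by congr leb; apply/funext => y /=; rewrite !cons_rowD addr0.
Qed.

(** Stated as a property of the matrix because it passes to products; every
    invertible matrix is then reached from block shears and scalings. *)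
Definition scales_leb n (A : 'M[R]_n) := forall S : set 'rV[R]_n,
  row_measurable S -> leb S = (`|\det A|%:E * leb [set x | S (x *m A)%R])%E.

Lemma scales_lebM n (A B : 'M[R]_n) :
  scales_leb A -> scales_leb B -> scales_leb (A *m B).
Proof.
move=> hA hB S mS; rewrite hB// hA; last exact: row_measurable_mul.
rewrite muleA -EFinM det_mulmx normrM mulrC; congr (_ * leb _)%E.
by apply/funext => x /=; rewrite mulmxA.
Qed.

Lemma cons_row_mul_block n x (y : 'rV[R]_n) a r c D :
  cons_row x y *m (block_mx a%:M r c D : 'M[R]_(1 + n)) =
  cons_row (x * a + (y *m c) 0 0) (x *: r + y *m D).
Proof.
rewrite [LHS](@mul_row_block _ 1 1 n 1 n); congr row_mx; last by rewrite mul_scalar_mx.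
by rewrite [X in _ + X = _]mx11_scalar -scalar_mxM -raddfD.
Qed.

Lemma scales_leb_lower n (c : 'cV[R]_n) :
  scales_leb (block_mx 1%:M 0 c 1%:M : 'M[R]_(1 + n)).
Proof.
move=> S mS; rewrite det_lblock !det1 mulr1.
apply: leb_scale_sections2 => //; first exact: row_measurable_mul.
move=> y; rewrite (@lebesgue_measure_affine _ 1 ((y *m c) 0 0) _ (oner_neq0 _)
  (measurable_section y mS)); congr (_ * mu1 _)%E.
apply/funext => x /=.
by rewrite cons_row_mul_block scaler0 add0r mulmx1 mulr1 mul1r.
Qed.

Lemma scales_leb_diag n (a : R) : a != 0 ->
  scales_leb (block_mx a%:M 0 0 1%:M : 'M[R]_(1 + n)).
Proof.
move=> a0 S mS; rewrite det_ublock det1 mulr1 det_scalar1.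
apply: leb_scale_sections2 => //; first exact: row_measurable_mul.
move=> y; rewrite (@lebesgue_measure_affine _ a 0 _ a0 (measurable_section y mS)).
congr (_ * mu1 _)%E; apply/funext => x /=.
by rewrite cons_row_mul_block scaler0 add0r !mulmx1 mulmx0 [X in x * a + X]mxE mulrC.
Qed.

Lemma scales_leb_upper n r (D : 'M[R]_n) : scales_leb D ->
  scales_leb (block_mx 1%:M r 0 D : 'M[R]_(1 + n)).
Proof.
move=> hD S mS; rewrite det_ublock det1 mul1r.
apply: leb_scale_sections1 => //; first exact: row_measurable_mul.
move=> x; have mSx := row_measurable_section x mS.
rewrite -(leb_translate (x *: r) mSx) hD; last exact: row_measurable_translate.
congr (_ * leb _)%E; apply/funext => y /=.
by rewrite cons_row_mul_block mulr1 mulmx0 [X in x + X]mxE addr0 addrC.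
Qed.

(** When the corner entry [a] is nonzero, clearing the first column writes the
    matrix as a lower shear, times an upper block matrix with corner 1, times the
    scaling of the first coordinate by [a]. Slicing along the first coordinate
    handles each factor. *)
Theorem unitmx_scales_leb n (A : 'M[R]_n) : A \in unitmx -> scales_leb A.
Proof.
elim: n A => [A _ S mS|n IH].
  rewrite det_mx00 normr1 mul1e; congr leb; apply/funext => x /=.
  by rewrite [x *m A]thinmx0 [x]thinmx0.
have upper1 r : scales_leb (block_mx 1%:M r 0 1%:M : 'M[R]_(1 + n)).
  by apply: scales_leb_upper; apply: IH; exact: unitmx1.
suff main (A : 'M[R]_(1 + n)) : A 0 0 != 0 -> A \in unitmx -> scales_leb A.
  suff all (A : 'M[R]_(1 + n)) : A \in unitmx -> scales_leb A by exact: all.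
  move=> uA; have [A0|] := eqVneq (A 0 0) 0; last by move=> ?; exact: main.
  (* The first column is nonzero: adding a suitable row to the first one makes
     the corner nonzero. *)
  have [k Ak0] : exists k : 'I_n, A (rshift 1 k) 0 != 0.
    apply/existsP; apply: contraT; rewrite negb_exists => /forallP col0.
    have : A *m delta_mx 0 (0 : 'I_1) = 0.
      rewrite -colE; apply/colP => i; rewrite !mxE.
      case: (@split_ordP 1 n i) => j ->.
        by rewrite ord1 -A0; congr (A _ _); exact: val_inj.
      by have := col0 j; rewrite negbK => /eqP.
    move=> /(congr1 (mulmx (invmx A))); rewrite mulKmx// mulmx0.
    move=> /matrixP/(_ 0 0); rewrite !mxE !eqxx/= => /eqP.
    by rewrite oner_eq0.
  pose E : 'M[R]_(1 + n) := block_mx 1%:M (delta_mx 0 k) 0 1%:M.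
  pose E' : 'M[R]_(1 + n) := block_mx 1%:M (- delta_mx 0 k) 0 1%:M.
  have E'E : E' *m E = 1%:M.
    rewrite mulmx_block !mulmx0 !mul0mx !mulmx1 !mul1mx !addr0 add0r subrr.
    by rewrite -scalar_mx_block.
  have uE : E \in unitmx by have /mulmx1_unit[] := E'E.
  have -> : A = E' *m (E *m A) by rewrite mulmxA E'E mul1mx.
  apply: scales_lebM; first exact: upper1.
  apply: main; last by rewrite unitmx_mul uE.
  have uEA : usubmx (E *m A) = usubmx A + row k (dsubmx A).
    rewrite -{1}[A]vsubmxK /E /block_mx mul_col_mx col_mxKu mul_row_col mul1mx.
    by rewrite -rowE.
  have -> : (E *m A) 0 0 = usubmx (E *m A) 0 0.
    by rewrite [RHS]mxE; congr (_ _ _); exact: val_inj.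
  rewrite uEA mxE (_ : usubmx A 0 0 = 0) ?add0r ?mxE//.
  by rewrite -A0; congr (A _ _); exact: val_inj.
move=> A00 uA; pose a := A 0 0; pose r := ursubmx A; pose c := dlsubmx A; pose D := drsubmx A.
have aE : ulsubmx A = a%:M.
  rewrite [LHS]mx11_scalar; congr (_%:M); rewrite !mxE.
  by congr (A _ _); exact: val_inj.
pose D' := D - a^-1 *: (c *m r).
have AE : A = block_mx 1%:M 0 (a^-1 *: c) 1%:M *m
   (block_mx 1%:M r 0 D' *m block_mx a%:M 0 0 1%:M).
  rewrite !mulmx_block !mulmx0 !mul0mx !mulmx1 !mul1mx !addr0 !add0r.
  rewrite -scalemxAl mul_mx_scalar scalerA mulVf// scale1r -scalemxAl /D' addrC subrK.
  by rewrite -[LHS]submxK aE.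
have uD' : D' \in unitmx.
  move: uA; rewrite !unitmxE AE !det_mulmx !det_ublock det_lblock !unitrM.
  by move=> /and3P[_ /andP[]].
rewrite AE; apply: scales_lebM; first exact: scales_leb_lower.
apply: scales_lebM; last exact: scales_leb_diag.
by apply: scales_leb_upper; exact: IH.
Qed.

End change_of_variables.

(** * Compact sets of row vectors *)

Section row_topology.
Context {R : realType}.
Local Notation T := (measurableTypeR R).

Lemma continuous_row (X : topologicalType) n (f : X -> 'rV[R]_n) :
  (forall j, continuous (fun x => f x 0 j)) -> continuous f.
Proof.
move=> cf x A /nbhs_ballP[e /= e0 eA].
have : \forall y \near x, forall j, ball (f x 0 j) e (f y 0 j).
  by apply: filter_forall => j; apply: cf; exact: nbhsx_ballx.
apply: filterS => y fxy; apply: eA; split=> // i j.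
by rewrite [i]ord1; exact: fxy.
Qed.

Lemma mulmxr_row_continuous m n (A : 'M[R]_(m, n)) :
  continuous (fun x : 'rV[R]_m => x *m A).
Proof.
apply: continuous_row => j.
rewrite (_ : (fun _ => _) = (fun x : 'rV[R]_m => \sum_i x 0 i * A i j)); last first.
  by apply/funext => x; rewrite mxE.
apply: continuous_big => [|i _].
  by move=> *; exact: add_continuous.
move=> x; apply: (@continuousM R 'rV[R]_m (fun v : 'rV[R]_m => v 0 i)).
  exact: coord_continuous.
exact: cst_continuous.
Qed.

Lemma mx_ballP n (x y : 'rV[R]_n) e : 0 < e ->
  ball x e y <-> forall j, `|x 0 j - y 0 j| < e.
Proof.
move=> e0; split=> [[_ xy] j|xy]; first exact: xy.
by split=> // i j; rewrite [i]ord1; exact: xy.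
Qed.

(** An open set is the union of the countably many rational boxes inside it, and
    boxes are measurable for the product sigma-algebra. *)
Lemma open_row_measurable n (U : set 'rV[R]_n) : open U -> row_measurable U.
Proof.
move=> oU.
pose e (k : nat) : R := k.+1%:R^-1.
pose q (p : {ffun 'I_n -> rat} * nat) : 'rV[R]_n := \row_j ratr (p.1 j).
pose box (p : {ffun 'I_n -> rat} * nat) : set 'rV[R]_n :=
  [set x | ball (q p) (e p.2) `<=` U /\ ball (q p) (e p.2) x].
have e0 k : 0 < e k by rewrite invr_gt0.
have -> : U = \bigcup_p box p.
  apply/seteqP; split=> [x Ux|x [p _ [pU px]]]; last exact: pU.
  have /nbhs_ballP[d /= d0 dU] : nbhs x U by exact: open_nbhs_nbhs.
  have [k kd] : exists k, e k < d / 2.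
    have [k _ /(_ k (leqnn _)) ?] :=
      near_infty_natSinv_lt (PosNum (divr_gt0 d0 (ltr0Sn R 1))).
    by exists k.
  have ex j : exists r : rat, ratr r \in `]x 0 j - e k, x 0 j + e k[.
    by apply: rat_in_itvoo; rewrite ltrD2l gtrN.
  pose p := ([ffun j => xchoose (ex j)], k).
  exists p => //; have pj j : `|q p 0 j - x 0 j| < e k.
    rewrite /q mxE /p/= ffunE; have := xchooseP (ex j).
    by rewrite in_itv/= ltr_norml => /andP[? ?]; apply/andP; split; lra.
  split; last by apply/mx_ballP.
  move=> y /(mx_ballP _ _ (e0 _)) /= py; apply: dU; apply/mx_ballP => // j.
  have := py j; have := pj j; rewrite !ltr_norml => /andP[? ?] /andP[? ?].
  by apply/andP; split; lra.
rewrite row_measurableE.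
rewrite (_ : tuple_of_row_set _ = \bigcup_p tuple_of_row_set (box p)); last first.
  by apply/seteqP; split=> t [p _ pt]; exists p.
apply: countable_bigcupT_measurable => [|p]; first exact: countableP.
have [pU|npU] := pselect (ball (q p) (e p.2) `<=` U); last first.
  rewrite (_ : tuple_of_row_set _ = set0)//.
  by apply/seteqP; split=> // t [].
rewrite (_ : tuple_of_row_set _ = \bigcap_(j in [set: 'I_n])
    (fun t : n.-tuple T => tnth t j) @^-1` ball (q p 0 j) (e p.2)).
  apply: fin_bigcap_measurable => // j _; rewrite -[X in measurable X]setTI.
  apply: measurable_tnth => //; apply: open_measurable; exact: ball_open.
apply/seteqP; split=> [t [_ /(mx_ballP _ _ (e0 _)) pt] j _|t pt].
  by have := pt j; rewrite mxE.
split=> //; apply/mx_ballP => // j; rewrite [in X in _ - X]mxE.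
exact: pt.
Qed.

Lemma closed_row_measurable n (S : set 'rV[R]_n) : closed S -> row_measurable S.
Proof.
move=> /closed_openC/open_row_measurable mS.
rewrite row_measurableE -(setCK (tuple_of_row_set S)); exact: measurableC.
Qed.

Lemma compact_row_closed n (S : set 'rV[R]_n) : compact S -> closed S.
Proof. by apply: compact_closed; exact: norm_hausdorff. Qed.

Lemma compact_row_measurable n (S : set 'rV[R]_n) : compact S -> row_measurable S.
Proof. by move=> /compact_row_closed/closed_row_measurable. Qed.

Lemma compact_image (X Y : topologicalType) (f : X -> Y) (A : set X) :
  continuous f -> compact A -> compact (f @` A).
Proof. by move=> cf; apply: continuous_compact; exact: continuous_subspaceT. Qed.

Definition cvx n (S : set 'rV[R]_n) := forall x y t, 0 <= t -> t <= 1 ->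
  S x -> S y -> S ((1 - t) *: x + t *: y).

Lemma convex_setP n (S : set 'rV[R]_n) :
  convex_set (S : set (convex_lmodType 'rV[R]_n)) <-> cvx S.
Proof.
split=> [cS x y t t0 t1 Sx Sy|cS x y l xS yS].
  have := cS y x (Itv01 t0 t1) (mem_set Sy) (mem_set Sx).
  by move=> /set_mem; rewrite /conv/= addrC.
apply: mem_set; rewrite /conv/= addrC; apply: cS.
- exact: ge0.
- exact: le1.
- exact: set_mem.
- exact: set_mem.
Qed.

End row_topology.

(** * Thickening a convex body in one direction *)

Section sections_of_convex_bodies.
Context {R : realType}.
Local Notation T := (measurableTypeR R).
Local Notation mu1 := (@lebesgue_measure R).

Lemma cons_rowZ n s x (y : 'rV[R]_n) : s *: cons_row x y = cons_row (s * x) (s *: y).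
Proof. by rewrite /cons_row (@scale_row_mx _ 1 1 n) scale_scalar_mx. Qed.

Lemma delta_cons_row n : delta_mx 0 0 = cons_row 1 0 :> 'rV[R]_n.+1.
Proof.
apply/rowP => i; rewrite [LHS]mxE eqxx/=; have [j ->|->] := unliftP ord0 i.
  by rewrite cons_rowS mxE.
by rewrite cons_row0 eqxx.
Qed.

Lemma compact_convex_section n (Y : set 'rV[R]_n.+1) y : compact Y -> cvx Y ->
  (exists x, Y (cons_row x y)) ->
  exists a b, a <= b /\ (forall x, Y (cons_row x y) <-> a <= x <= b).
Proof.
move=> cY vY [x0 Yx0].
pose C := \bigcap_(i in [set: 'I_n]) [set v : 'rV[R]_n.+1 | v 0 (lift 0 i) = y 0 i].
have cC : closed C.
  apply: closed_bigI => i _.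
  apply: (@closed_comp _ _ (fun v : 'rV[R]_n.+1 => v 0 (lift 0 i)) [set y 0 i]).
    by move=> v _; exact: coord_continuous.
  exact: closed_eq.
have cW : compact (Y `&` C) by exact: compact_closedI.
have YC x : Y (cons_row x y) -> (Y `&` C) (cons_row x y).
  by split=> // i _ /=; rewrite cons_rowS.
have CE v : C v -> v = cons_row (v 0 0) y.
  move=> Cv; apply/rowP => i; have [j ->|->] := unliftP ord0 i.
    by rewrite cons_rowS; exact: Cv.
  by rewrite cons_row0.
have W0 : Y `&` C !=set0 by exists (cons_row x0 y); exact: YC.
have cf : {within Y `&` C, continuous (fun v : 'rV[R]_n.+1 => v 0 0)}.
  by apply: continuous_subspaceT; exact: coord_continuous.
have [u /set_mem[Yu Cu] maxu] := EVT_max_rV W0 cW cf.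
have [v /set_mem[Yv Cv] minv] := EVT_min_rV W0 cW cf.
have vu : v 0 0 <= u 0 0 by exact/maxu/mem_set.
exists (v 0 0), (u 0 0); split=> // x; split=> [/YC Yx|/andP[vx xu]].
  have xW := mem_set Yx.
  by have := maxu _ xW; have := minv _ xW; rewrite cons_row0 => -> ->.
have [eqvu|ltvu] := eqVneq (v 0 0) (u 0 0).
  have -> : x = v 0 0 by apply/eqP; rewrite eq_le vx eqvu xu.
  by rewrite -CE.
have {}ltvu : 0 < u 0 0 - v 0 0 by rewrite subr_gt0 lt_neqAle ltvu.
pose t := (x - v 0 0) / (u 0 0 - v 0 0).
have <- : (1 - t) *: v + t *: u = cons_row x y.
  rewrite {1}(CE _ Cv) {1}(CE _ Cu).
  rewrite !cons_rowZ cons_rowD -scalerDl subrK scale1r; congr cons_row.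
  by rewrite /t; field; rewrite gt_eqF.
apply: vY => //; first by rewrite divr_ge0 ?subr_ge0// ltW.
by rewrite ler_pdivrMr// mul1r lerD2r.
Qed.

(** Slicing along a coordinate axis turns the identity into the statement that
    thickening a nonempty compact interval by one unit adds 1 to its length. *)
Lemma leb_thicken_head n (Y : set 'rV[R]_n.+1) : compact Y -> cvx Y ->
  row_measurable [set t : 'rV[R]_n.+1 | exists2 s, 0 <= s <= 1 & Y (t - s *: delta_mx 0 0)] ->
  row_measurable [set t : 'rV[R]_n.+1 | 0 <= t 0 0 <= 1 /\ exists s, Y (t + s *: delta_mx 0 0)] ->
  leb [set t : 'rV[R]_n.+1 | exists2 s, 0 <= s <= 1 & Y (t - s *: delta_mx 0 0)] =
  (leb Y + leb [set t : 'rV[R]_n.+1 | (0 <= t 0 0 <= 1 /\ exists s, Y (t + s *: delta_mx 0 0))%R])%E.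
Proof.
move=> cY vY mE mF; apply: leb_add_sections2 => //.
  exact: compact_row_measurable.
move=> y.
have addE x s : cons_row x y + s *: delta_mx 0 0 = cons_row (x + s) y.
  by rewrite delta_cons_row cons_rowZ cons_rowD scaler0 addr0 mulr1.
have subE x s : cons_row x y - s *: delta_mx 0 0 = cons_row (x - s) y.
  by rewrite -scaleNr addE.
have [[x0 Yx0]|nY] := pselect (exists x, Y (cons_row x y)); last first.
  have z (A : set T) : (forall x, ~ A x) -> mu1 A = 0%E.
    by move=> nA; rewrite (_ : A = set0) ?measure0//; apply/seteqP; split=> // x /nA.
  rewrite !z ?adde0// => x.
  - by move=> /= [_ [s]]; rewrite addE => Ys; apply: nY; eexists; exact: Ys.
  - by move=> Yx; apply: nY; exists x.
  - by move=> /= [s _]; rewrite subE => Ys; apply: nY; eexists; exact: Ys.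
have [a [b [ab YE]]] : exists a b, a <= b /\ (forall x, Y (cons_row x y) <-> a <= x <= b).
  by apply: compact_convex_section => //; exists x0.
rewrite (_ : [set x | _] = `[a, b + 1]%classic); last first.
  apply/funext => x; apply/propext; rewrite /= in_itv/=; split.
    move=> [s /andP[s0 s1]]; rewrite subE => /YE/andP[? ?].
    by apply/andP; split; lra.
  move=> /andP[ax xb]; exists (if x <= b then 0 else x - b).
    case: (leP x b) => xb'; first by rewrite lexx ler01.
    by apply/andP; split; lra.
  by rewrite subE; apply/YE; case: (leP x b) => xb'; apply/andP; split; lra.
rewrite [X in (mu1 X + _)%E](_ : _ = `[a, b]%classic); last first.
  by apply/funext => x; apply/propext; rewrite /= in_itv/=; exact: YE.
rewrite [X in (_ + mu1 X)%E](_ : _ = `[0, 1]%classic); last first.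
  apply/funext => x; apply/propext; rewrite /mkset cons_row0 in_itv/=; split=> [[]//|x01].
  by split=> //; exists (x0 - x); rewrite addE addrC subrK.
rewrite !lebesgue_measure_itv/= !lte_fin ltr01.
have -> : (a < b + 1)%R by lra.
case: ltP => ba; rewrite -?EFinB ?add0e -?EFinD; congr (_%:E); lra.
Qed.

(** The transposition of the coordinates [0] and [i] preserves the volume and
    moves the direction [i] to the front. *)
Lemma leb_thicken n (i : 'I_n) (Y : set 'rV[R]_n) : compact Y -> cvx Y ->
  row_measurable [set t : 'rV[R]_n | exists2 s, 0 <= s <= 1 & Y (t - s *: delta_mx 0 i)] ->
  row_measurable [set t : 'rV[R]_n | 0 <= t 0 i <= 1 /\ exists s, Y (t + s *: delta_mx 0 i)] ->
  leb [set t : 'rV[R]_n | exists2 s, 0 <= s <= 1 & Y (t - s *: delta_mx 0 i)] =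
  (leb Y + leb [set t : 'rV[R]_n | (0 <= t 0 i <= 1 /\ exists s, Y (t + s *: delta_mx 0 i))%R])%E.
Proof.
case: n i Y => [[]//|n] i Y cY vY mE mF.
pose P : 'M[R]_n.+1 := perm_mx (tperm 0 i).
have PP : P *m P = 1%:M by rewrite -perm_mxM tperm2 perm_mx1.
have uP : P \in unitmx by exact: unitmx_perm.
have dP : `|\det P| = 1 by rewrite det_perm normr_sign.
have eP : delta_mx 0 0 *m P = delta_mx 0 i :> 'rV[R]_n.+1.
  by rewrite -rowE; apply/rowP => j; rewrite !mxE tpermL eq_sym.
have xP (x : 'rV[R]_n.+1) : (x *m P) 0 i = x 0 0.
  have -> : P = perm_mx (tperm 0 i)^-1 by rewrite tpermV.
  by rewrite -col_permE mxE tpermR.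
have lebP (S : set 'rV[R]_n.+1) : row_measurable S -> leb S = leb [set x | S (x *m P)].
  by move=> mS; rewrite (unitmx_scales_leb uP mS) dP mul1e.
have cY' : compact [set x | Y (x *m P)].
  rewrite (_ : mkset _ = (fun x => x *m P) @` Y).
    by apply: compact_image => //; exact: mulmxr_row_continuous.
  apply/seteqP; split=> [x Yx|_ [x Yx <-]]; last by rewrite /= -mulmxA PP mulmx1.
  by exists (x *m P) => //; rewrite -mulmxA PP mulmx1.
rewrite (lebP _ mE) (lebP _ mF) (lebP _ (compact_row_measurable cY)).
have addE (x : 'rV[R]_n.+1) s : (x + s *: delta_mx 0 0) *m P = x *m P + s *: delta_mx 0 i.
  by rewrite mulmxDl -scalemxAl eP.
have subE (x : 'rV[R]_n.+1) s : (x - s *: delta_mx 0 0) *m P = x *m P - s *: delta_mx 0 i.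
  by rewrite -scaleNr addE scaleNr.
have := @leb_thicken_head n [set x | Y (x *m P)] cY'.
have -> : [set t : 'rV[R]_n.+1 | exists2 s, 0 <= s <= 1 & Y ((t - s *: delta_mx 0 0) *m P)] =
   [set x | exists2 s, 0 <= s <= 1 & Y (x *m P - s *: delta_mx 0 i)].
  by apply/seteqP; split=> x -[s s01] Ys; exists s => //; move: Ys;
    rewrite /= subE.
have -> : [set t : 'rV[R]_n.+1 | 0 <= t 0 0 <= 1 /\ exists s, Y ((t + s *: delta_mx 0 0) *m P)] =
   [set x : 'rV[R]_n.+1 | 0 <= (x *m P) 0 i <= 1 /\ exists s, Y (x *m P + s *: delta_mx 0 i)].
  by apply/seteqP; split=> x /=; rewrite xP => -[x01 [s Ys]]; split=> //; exists s;
    move: Ys; rewrite /= addE.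
apply.
- move=> x y t t0 t1 /= Yx Yy; rewrite mulmxDl -!scalemxAl; exact: vY.
- exact: (row_measurable_mul P mE).
- exact: (row_measurable_mul P mF).
Qed.

End sections_of_convex_bodies.

(** * Thickening by the unit cube *)

Section slabs.
Context {R : realType} {n : nat}.

(** The coordinates in [J] are forgotten and replaced by a unit segment: [slab X
    set0 J] is the shadow of [X] along these axes times a unit cube. The
    coordinates in [D] are thickened by a unit segment. *)
Definition slab (X : set 'rV[R]_n) (D J : {set 'I_n}) : set 'rV[R]_n :=
  [set t : 'rV[R]_n | exists2 k : 'rV[R]_n, X k & forall j,
     if j \in J then is_true (0 <= t 0 j <= 1)
     else if j \in D then is_true (k 0 j <= t 0 j <= k 0 j + 1)
     else t 0 j = k 0 j].

Definition unit_cube : set 'rV[R]_n := [set c : 'rV[R]_n | forall j, 0 <= c 0 j <= 1].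

Lemma compact_unit_cube : compact unit_cube.
Proof.
have := @rV_compact R n (fun=> `[0, 1]%classic) (fun=> @segment_compact _ _ _).
by congr compact; apply/funext => v; apply/propext; split=> h j; have := h j;
  rewrite /= in_itv.
Qed.

Lemma slab_compact X (D J : {set 'I_n}) : compact X -> compact (slab X D J).
Proof.
move=> cX.
pose f (p : 'rV[R]_n * 'rV[R]_n) : 'rV[R]_n :=
  \row_j (if j \in J then p.2 0 j else if j \in D then p.1 0 j + p.2 0 j else p.1 0 j).
have -> : slab X D J = f @` (X `*` unit_cube).
  apply/seteqP; split=> [t [k Xk kt]|_ [[k s] [/= Xk s01] <-]].
    exists (k, \row_j (if j \in J then t 0 j else if j \in D then t 0 j - k 0 j else 0)).
      split=> //= j; rewrite mxE; have := kt j; case: (j \in J) => //.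
      by case: (j \in D); rewrite ?lexx ?ler01// => /andP[? ?]; apply/andP; split; lra.
    apply/rowP => j; rewrite !mxE /=; have := kt j; case: (j \in J) => //.
    by case: (j \in D) => // _; rewrite addrC subrK.
  exists k => // j; rewrite mxE /=; have := s01 j; case: (j \in J) => //.
  by case: (j \in D) => // /andP[? ?]; apply/andP; split; lra.
apply: compact_image; last by apply: compact_setX => //; exact: compact_unit_cube.
have c1 j : continuous (fun p : 'rV[R]_n * 'rV[R]_n => p.1 0 j).
  move=> p; apply: (@continuous_comp _ _ _ (fun p : 'rV[R]_n * 'rV[R]_n => p.1)
    (fun v : 'rV[R]_n => v 0 j)); first exact: cvg_fst.
  exact: coord_continuous.
have c2 j : continuous (fun p : 'rV[R]_n * 'rV[R]_n => p.2 0 j).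
  move=> p; apply: (@continuous_comp _ _ _ (fun p : 'rV[R]_n * 'rV[R]_n => p.2)
    (fun v : 'rV[R]_n => v 0 j)); first exact: cvg_snd.
  exact: coord_continuous.
apply: continuous_row => j.
have [jJ|jJ] := boolP (j \in J).
  by rewrite (_ : (fun _ => _) = (fun p : 'rV[R]_n * 'rV[R]_n => p.2 0 j))//; apply/funext => p; rewrite mxE jJ.
have [jD|jD] := boolP (j \in D); last first.
  rewrite (_ : (fun _ => _) = (fun p : 'rV[R]_n * 'rV[R]_n => p.1 0 j))//; apply/funext => p.
  by rewrite mxE (negbTE jJ) (negbTE jD).
rewrite (_ : (fun _ => _) = (fun p : 'rV[R]_n * 'rV[R]_n => p.1 0 j + p.2 0 j)); last first.
  by apply/funext => p; rewrite mxE (negbTE jJ) jD.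
by move=> p; apply: cvgD; [exact: c1|exact: c2].
Qed.

Lemma slab_cvx X (D J : {set 'I_n}) : cvx X -> cvx (slab X D J).
Proof.
move=> vX x y t t0 t1 [k Xk kx] [l Xl ly].
exists ((1 - t) *: k + t *: l); first exact: vX.
move=> j; rewrite !mxE; have := kx j; have := ly j.
case: ifP => _; first by move=> /andP[? ?] /andP[? ?]; apply/andP; split; nra.
case: ifP => _; first by move=> /andP[? ?] /andP[? ?]; apply/andP; split; nra.
by move=> -> ->.
Qed.

Lemma slab_thicken X (D J : {set 'I_n}) i : i \notin D -> i \notin J ->
  slab X (i |: D)%SET J =
  [set t : 'rV[R]_n | exists2 s, 0 <= s <= 1 & slab X D J (t - s *: delta_mx 0 i)].
Proof.
move=> iD iJ; apply/seteqP; split=> [t [k Xk kt]|t [s s01 [k Xk kt]]].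
  exists (t 0 i - k 0 i).
    have := kt i; rewrite (negbTE iJ) setU11.
    by move=> /andP[? ?]; apply/andP; split; lra.
  exists k => // j; have := kt j; rewrite !mxE eqxx in_setU1/=.
  have [->|ji] := eqVneq j i.
    by rewrite (negbTE iJ) (negbTE iD)/= => _; rewrite mulr1 subKr.
  by rewrite mulr0 subr0.
exists k => // j; have := kt j; rewrite !mxE eqxx in_setU1/=.
have [->|ji] := eqVneq j i; last by rewrite mulr0 subr0.
rewrite (negbTE iJ) (negbTE iD)/= mulr1 => <-.
by move: s01 => /andP[? ?]; apply/andP; split; lra.
Qed.

Lemma slab_flatten X (D J : {set 'I_n}) i : i \notin D -> i \notin J ->
  slab X D (i |: J)%SET =
  [set t : 'rV[R]_n | 0 <= t 0 i <= 1 /\ exists s, slab X D J (t + s *: delta_mx 0 i)].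
Proof.
move=> iD iJ; apply/seteqP; split=> [t [k Xk kt]|t [ti [s [k Xk kt]]]].
  split; first by have := kt i; rewrite setU11.
  exists (k 0 i - t 0 i), k => // j; have := kt j; rewrite !mxE eqxx in_setU1/=.
  have [->|ji] := eqVneq j i; last by rewrite mulr0 addr0.
  by rewrite (negbTE iJ) (negbTE iD)/= mulr1 addrC subrK.
exists k => // j; have := kt j; rewrite !mxE eqxx in_setU1/=.
by have [->|ji] := eqVneq j i; rewrite // mulr0 addr0.
Qed.

Lemma leb_slab_step X (D J : {set 'I_n}) i : compact X -> cvx X -> i \notin D -> i \notin J ->
  leb (slab X (i |: D)%SET J) = (leb (slab X D J) + leb (slab X D (i |: J)%SET))%E.
Proof.
move=> cX vX iD iJ.
have c D' J' := compact_row_measurable (slab_compact (D := D') (J := J') cX).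
have := c (i |: D)%SET J; have := c D (i |: J)%SET.
rewrite slab_thicken// slab_flatten// => mF mE.
by apply: leb_thicken => //; [exact: slab_compact|exact: slab_cvx].
Qed.

Lemma sum_subsets_setU1 (D : {set 'I_n}) i (F : {set 'I_n} -> \bar R) : i \notin D ->
  (\sum_(K : {set 'I_n} | K \subset i |: D) F K =
   \sum_(K : {set 'I_n} | K \subset D) F K + \sum_(K : {set 'I_n} | K \subset D) F (i |: K)%SET)%E.
Proof.
move=> iD; rewrite (bigID (fun K : {set 'I_n} => i \in K)) [LHS]addeC /=; congr (_ + _)%E.
  apply: eq_bigl => K; apply/andP/idP => [[KD iK]|KD].
    by apply/fintype.subsetP => j jK; have := fintype.subsetP KD _ jK; rewrite in_setU1 => /orP[/eqP ji|//];
      rewrite -ji jK in iK.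
  split; first by apply: (fintype.subset_trans KD); exact: finset.subsetUr.
  by apply: contra iD => /(fintype.subsetP KD).
rewrite (reindex_onto (fun K => i |: K)%SET (fun K => K :\ i)%SET)/=; last first.
  by move=> K /andP[_ iK]; rewrite finset.setD1K.
apply: eq_bigl => K; rewrite setU11 andbT; apply/andP/idP => [[KD /eqP iK]|KD].
  rewrite -iK; apply/fintype.subsetP => j; rewrite !in_setD1 !in_setU1 => /andP[/negbTE ji].
  rewrite ji/= => jK; have := fintype.subsetP KD j; rewrite !in_setU1 ji jK/=; exact.
split; first exact: finset.setUS.
by rewrite finset.setU1K//; apply: contra iD => /(fintype.subsetP KD).
Qed.

Lemma slab_full X : slab X [set: 'I_n]%SET finset.set0 = minkowski_sum X unit_cube.
Proof.
apply/seteqP; split=> [t [k Xk kt]|_ [k Xk [c c01 <-]]].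
  exists k => //; exists (t - k); last by rewrite addrC subrK.
  move=> j; have := kt j; rewrite finset.in_set0 finset.in_setT !mxE.
  by move=> /andP[? ?]; apply/andP; split; lra.
exists k => // j; rewrite finset.in_set0 finset.in_setT !mxE.
by have /andP[? ?] := c01 j; apply/andP; split; lra.
Qed.

Lemma compact_cube_sum X : compact X -> compact (minkowski_sum X unit_cube).
Proof. by rewrite -slab_full; exact: slab_compact. Qed.

(** Thickening one coordinate direction after the other, the volume of
    [X + unit_cube] splits at each direction into a part where that direction is
    not thickened and a part where it has been replaced by a unit segment. *)
Lemma leb_cube_sum_slabs X : compact X -> cvx X ->
  leb (minkowski_sum X unit_cube) = (\sum_(J : {set 'I_n}) leb (slab X finset.set0 J))%E.
Proof.
move=> cX vX.
have H (r : seq 'I_n) (J : {set 'I_n}) : uniq r -> (forall i, i \in r -> i \notin J) ->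
    leb (slab X [set i in r]%SET J) =
    (\sum_(K : {set 'I_n} | K \subset [set i in r]%SET) leb (slab X finset.set0 (K :|: J)%SET))%E.
  elim: r J => [|i r IH] J.
    move=> _ _; have -> : [set i in [::]]%SET = finset.set0 :> {set 'I_n}.
      by apply/finset.setP => i; rewrite !inE.
    by under eq_bigl do rewrite finset.subset0; rewrite big_pred1_eq finset.set0U.
  move=> /= /andP[ir ur] rJ.
  have -> : [set j in i :: r]%SET = (i |: [set j in r])%SET.
    by apply/finset.setP => j; rewrite !inE.
  have iD : i \notin [set j in r]%SET by rewrite inE.
  have iJ : i \notin J by apply: rJ; rewrite mem_head.
  rewrite leb_slab_step// sum_subsets_setU1//; congr (_ + _)%E.
    by rewrite IH// => j jr; apply: rJ; rewrite in_cons jr orbT.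
  rewrite IH//.
    by apply: eq_bigr => K _; rewrite finset.setUCA finset.setUA.
  move=> j jr; rewrite in_setU1 negb_or rJ ?in_cons ?jr ?orbT// andbT.
  by apply: contra ir => /eqP <-.
have := H (enum 'I_n) finset.set0 (enum_uniq _) (fun i _ => negbT (finset.in_set0 i)).
have -> : [set i in enum 'I_n]%SET = [set: 'I_n]%SET.
  by apply/finset.setP => i; rewrite !inE mem_enum.
rewrite slab_full => ->; apply: eq_big => [K|K _]; first by rewrite finset.subsetT.
by rewrite finset.setU0.
Qed.

End slabs.

(** * Volumes of projections and of faces of the parallelepiped *)

Section bound_terms.
Context {R : realType}.
Local Notation T := (measurableTypeR R).

Lemma lsubmx_cons_row p q x (y : 'rV[R]_(p + q)) :
  @lsubmx _ 1 p.+1 q (cons_row x y) = cons_row x (lsubmx y).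
Proof.
apply/rowP => i; rewrite mxE; have [j ->|->] := unliftP ord0 i.
  rewrite (_ : lshift q (lift ord0 j) = lift ord0 (lshift q j)); last exact: val_inj.
  by rewrite !cons_rowS mxE.
rewrite (_ : lshift q ord0 = ord0); last exact: val_inj.
by rewrite !cons_row0.
Qed.

Lemma rsubmx_cons_row p q x (y : 'rV[R]_(p + q)) :
  @rsubmx _ 1 p.+1 q (cons_row x y) = rsubmx y.
Proof.
apply/rowP => i; rewrite mxE [RHS]mxE.
rewrite (_ : rshift p.+1 i = lift ord0 (rshift p i)); last exact: val_inj.
by rewrite cons_rowS.
Qed.

(** Splitting off the first coordinate of the left factor reduces the claim to
    smaller [p]; for [p = 0] the measure of [A] is [1] or [0]. *)
Lemma leb_prod p q (A : set 'rV[R]_p) (B : set 'rV[R]_q) :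
  row_measurable A -> row_measurable B ->
  leb [set x : 'rV[R]_(p + q) | A (lsubmx x) /\ B (rsubmx x)] = (leb A * leb B)%E.
Proof.
elim: p A => [|p IH] A mA mB.
  have -> : [set x : 'rV[R]_(0 + q) | A (lsubmx x) /\ B (rsubmx x)] =
     [set x : 'rV[R]_q | A 0 /\ B x].
    apply/funext => x /=; rewrite [lsubmx x]thinmx0; congr (_ /\ B _).
    by apply/rowP => i; rewrite mxE; congr (x _ _); exact: val_inj.
  have rE (t : 0.-tuple T) : \row_i tnth t i = 0 :> 'rV[R]_0 by exact: thinmx0.
  have [A0|nA0] := pselect (A 0).
    have -> : leb A = 1%E by rewrite /leb/= diracE mem_set// /tuple_of_row_set/= rE.
    by rewrite mul1e; congr leb; apply/seteqP; split=> [x []|x].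
  have -> : leb A = 0%E.
    by rewrite /leb/= diracE memNset// /tuple_of_row_set/= rE.
  rewrite mul0e (_ : [set x | _] = set0) ?leb0//.
  by apply/seteqP; split=> // x [].
rewrite (lebE1 A) -ge0_integralZr//; last 3 first.
- exact: measurable_fun_section1.
- by move=> x _; exact: leb_ge0.
- exact: leb_ge0.
rewrite (@lebE1 _ (p + q)); apply: eq_integral => x _.
rewrite -IH//; last exact: row_measurable_section.
congr leb; apply/funext => y /=.
by rewrite lsubmx_cons_row rsubmx_cons_row.
Qed.

Lemma vol_orthonormal n (k : nat) (L : 'M[R]_n) : \rank L = k ->
  exists2 B : 'M[R]_(k, n), orthonormal_basis L B &
    forall S, vol k L S = leb [set t | S (t *m B)].
Proof.
move=> rL; case: k / rL.
exists (xget 0 [set B : 'M[R]_(\rank L, n) | orthonormal_basis L B]) => //.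
by have [B oB] := orthonormal_basis_exists L; exact: (xgetPex 0 (ex_intro _ B oB)).
Qed.

Section frame.
Variables (n : nat) (z : 'I_n -> 'rV[R]_n) (J : {set 'I_n}).
Let Z := \matrix_j z j.
Let D : 'M[R]_n := diag_mx (\row_j (j \in J)%:R).

Lemma mul_diag_set (c : 'rV[R]_n) j : (c *m D) 0 j = if j \in J then c 0 j else 0.
Proof. by rewrite mul_mx_diag !mxE; case: ifP => _; rewrite ?mulr1 ?mulr0. Qed.

Lemma diag_set_idem : D *m D = D.
Proof.
apply/row_matrixP => i; rewrite !rowE mulmxA; apply/rowP => j.
by rewrite mul_diag_set; case: ifP => // jJ; rewrite mul_diag_set jJ.
Qed.

Lemma mulmx_sum_rows (c : 'rV[R]_n) : c *m Z = \sum_j c 0 j *: z j.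
Proof. by rewrite mulmx_sum_row; apply: eq_bigr => j _; rewrite rowK. Qed.

Lemma mulmx_sum_rows_set (c : 'rV[R]_n) :
  c *m D *m Z = \sum_(j in J) c 0 j *: z j.
Proof.
rewrite mulmx_sum_rows [RHS]big_mkcond; apply: eq_bigr => j _.
by rewrite mul_diag_set; case: ifP => // _; rewrite scale0r.
Qed.

Lemma segment_sumE : segment_sum J z = [set c *m D *m Z | c in unit_cube].
Proof.
rewrite /segment_sum.
suff H (r : seq 'I_n) : uniq r ->
    \big[minkowski_sum/[set 0]]_(j <- r | j \in J) segment 0 (z j) =
    [set \sum_(j <- r | j \in J) c 0 j *: z j | c in unit_cube].
  rewrite H ?index_enum_uniq//; apply/seteqP; split=> _ [c c01 <-]; exists c => //.
    by rewrite mulmx_sum_rows_set.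
  by rewrite mulmx_sum_rows_set.
have cube0 : unit_cube (0 : 'rV[R]_n) by move=> j; rewrite mxE lexx ler01.
elim: r => [_|i r IH /= /andP[ir ur]].
  rewrite big_nil; apply/seteqP; split=> [_ ->|_ [c c01 <-]]; last by rewrite big_nil.
  by exists 0; rewrite ?big_nil.
rewrite big_cons; case: ifP => iJ; last first.
  by rewrite IH//; apply/seteqP; split=> _ [c c01 <-]; exists c; rewrite ?big_cons ?iJ.
rewrite IH//; apply/seteqP; split.
  move=> _ [_ [t /= + <-]] [_ [c c01 <-] <-]; rewrite in_itv/= => t01.
  exists (\row_j if j == i then t else c 0 j).
    by move=> j; rewrite mxE; case: ifP.
  rewrite big_cons iJ mxE eqxx scaler0 add0r; congr (_ + _).
  rewrite big_seq_cond [RHS]big_seq_cond; apply: eq_bigr => j /andP[jr _].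
  by rewrite mxE; case: eqP => // ji; rewrite -ji jr in ir.
move=> _ [c c01 <-]; rewrite big_cons iJ; exists (c 0 i *: z i).
  by exists (c 0 i); [rewrite /= in_itv/=; exact: c01|rewrite scaler0 add0r].
by exists (\sum_(j <- r | j \in J) c 0 j *: z j) => //; exists c.
Qed.

Lemma lin_hullE : (lin_hull J z :=: D *m Z)%MS.
Proof.
apply/eqmxP/andP; split.
  apply/sumsmx_subP => j jJ; rewrite genmxE.
  have -> : z j = delta_mx 0 j *m D *m Z.
    rewrite mulmx_sum_rows_set (bigD1 j)//= mxE !eqxx scale1r big1 ?addr0// => k /andP[_ kj].
    by rewrite mxE eqxx/= (negbTE kj) scale0r.
  by rewrite -mulmxA submxMl.
apply/row_subP => i; rewrite rowE mulmxA mulmx_sum_rows_set.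
apply: summx_sub => j jJ; apply: scalemx_sub.
by rewrite (submx_trans _ (sumsmx_sup j _ (submx_refl _)))// genmxE.
Qed.

End frame.

(** The spans of the [z j] with [j] inside and outside [J] have ranks at most
    [#|J|] and [#|~: J|], and together they span everything. *)
Lemma rank_lin_hull n (z : 'I_n -> 'rV[R]_n) (J : {set 'I_n}) :
  row_free (\matrix_j z j) -> \rank (lin_hull J z) = #|J|.
Proof.
move=> fz.
have le (I : {set 'I_n}) : (\rank (lin_hull I z) <= #|I|)%N.
  rewrite -sum1_card /lin_hull.
  elim/big_ind2 : _ => [|m1 k1 m2 k2 h1 h2|j jI]; first by rewrite mxrank0.
    by apply: leq_trans (mxrank_adds_leqif _ _).1 _; exact: leq_add.
  by rewrite genmxE rank_leq_row.
apply/eqP; rewrite eqn_leq le/=.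
have full : (\rank (\matrix_j z j) <= \rank (lin_hull J z + lin_hull (~: J)%SET z)%MS)%N.
  apply/mxrankS/row_subP => j; rewrite rowK.
  have [jJ|jJ] := boolP (j \in J).
    apply: submx_trans (addsmxSl _ _).
    by rewrite (submx_trans _ (sumsmx_sup j _ (submx_refl _)))// genmxE.
  apply: submx_trans (addsmxSr _ _).
  rewrite (submx_trans _ (sumsmx_sup j _ (submx_refl _)))// ?genmxE//.
  by rewrite finset.in_setC.
have := leq_trans full (mxrank_adds_leqif _ _).1; move/eqP: fz => ->.
have := cardsC J; rewrite card_ord.
move=> cJ full'.
rewrite -(leq_add2r (\rank (lin_hull (~: J)%SET z))); apply: leq_trans full'.
by rewrite -[X in (_ <= X)%N]cJ leq_add2l.
Qed.

(** The reflection [1 - 2 D] conjugates [1 - N] to its inverse [1 + N]. This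
    applies when the [z j] with [j \notin J] are projected orthogonally to the span
    of those with [j \in J], [D] selecting the coordinates in [J]. *)
Lemma det_unipotent n (D N : 'M[R]_n) :
  D *m D = D -> D *m N = 0 -> N *m D = N -> `|\det (1%:M - N)| = 1.
Proof.
move=> DD DN ND.
have NN : N *m N = 0 by rewrite -{1}ND -mulmxA DN mulmx0.
pose S := 1%:M - (D + D).
have SS : S *m S = 1%:M.
  rewrite /S mulmxBl mul1mx mulmxBr mulmx1 mulmxDl !mulmxDr !DD.
  by rewrite opprB addrK subrK.
have SN : S *m N = N by rewrite mulmxBl mul1mx mulmxDl DN addr0 subr0.
have NS : N *m S = - N by rewrite mulmxBr mulmx1 mulmxDr ND opprD addrA subrr add0r.
clearbody S.
have SNS : S *m (1%:M - N) *m S = 1%:M + N.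
  by rewrite mulmxBr mulmx1 SN mulmxBl SS NS opprK.
have dSS : \det S * \det S = 1 by rewrite -det_mulmx SS det1.
have : \det (1%:M - N) * \det (1%:M + N) = 1.
  by rewrite -det_mulmx mulmxDr mulmx1 mulmxBl NN mul1mx subr0 subrK det1.
rewrite -SNS !det_mulmx mulrAC dSS mul1r -expr2 => /eqP.
by rewrite sqrf_eq1 => /orP[]/eqP ->; rewrite ?normrN normr1.
Qed.

Lemma rank_orth_compl n (L : 'M[R]_n) : \rank (orth_compl L) = (n - \rank L)%N.
Proof. by rewrite /orth_compl mxrank_ker mxrank_tr. Qed.

Lemma orth_complP n (L : 'M[R]_n) (x : 'rV[R]_n) : (x <= orth_compl L)%MS = (L *m x^T == 0).
Proof.
rewrite /orth_compl; apply/idP/eqP => [/sub_kermxP h|h].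
  by rewrite -[LHS]trmxK trmx_mul trmxK h trmx0.
by apply/sub_kermxP; rewrite -[LHS]trmxK trmx_mul trmxK h trmx0.
Qed.

Section orthonormal_frames.
Variables (p q : nat).
Local Notation n := (p + q)%N.
Variables (L : 'M[R]_n) (B : 'M[R]_(p, n)) (B' : 'M[R]_(q, n)).
Hypotheses (oB : orthonormal_basis (orth_compl L) B) (oB' : orthonormal_basis L B').

Let C := col_mx B B'.

Lemma orth_frames : B' *m B^T = 0.
Proof.
have [_ B'L] := oB'; have [_ BL] := oB.
have : (B <= orth_compl L)%MS by rewrite BL.
rewrite /orth_compl => /sub_kermxP BLT.
have /submxP[E ->] : (B' <= L)%MS by rewrite B'L.
by rewrite -mulmxA -[L *m _]trmxK trmx_mul trmxK BLT trmx0 mulmx0.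
Qed.

Lemma frame_orthogonal : C *m C^T = 1%:M.
Proof.
have [B'1 _] := oB'; have [B1 _] := oB.
rewrite tr_col_mx mul_col_row B1 B'1 orth_frames.
rewrite -[B *m B'^T]trmxK trmx_mul trmxK orth_frames trmx0.
by rewrite -scalar_mx_block.
Qed.

Lemma frame_complete : B^T *m B + B'^T *m B' = 1%:M.
Proof.
have := mulmx1C frame_orthogonal.
by rewrite tr_col_mx mul_row_col.
Qed.

Lemma det_frame : `|\det C^T| = 1.
Proof.
have := congr1 determinant frame_orthogonal.
rewrite det_mulmx det_tr det1 -expr2 => /eqP.
by rewrite sqrf_eq1 => /orP[]/eqP ->; rewrite ?normrN normr1.
Qed.

Lemma orth_proj_frame (K : set 'rV[R]_n) :
  [set s | orth_proj (orth_compl L) K (s *m B)] = [set x *m B^T | x in K].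
Proof.
have [B1 BL] := oB.
have perpE (w : 'rV[R]_n) : (w <= orth_compl (orth_compl L))%MS = (w *m B^T == 0).
  rewrite orth_complP.
  have /eqmxP/andP[/submxP[E BE] /submxP[F LF]] := BL.
  apply/eqP/eqP => h.
    by rewrite -[LHS]trmxK trmx_mul trmxK BE -mulmxA h mulmx0 trmx0.
  by rewrite LF -mulmxA -[B *m w^T]trmxK trmx_mul trmxK h trmx0 mulmx0.
apply/seteqP; split=> [s [_ [x Kx]]|_ [x Kx <-]].
  by rewrite perpE mulmxBl -mulmxA B1 mulmx1 subr_eq0 => /eqP ?; exists x.
split; first by rewrite -BL submxMl.
by exists x => //; rewrite perpE mulmxBl -!mulmxA B1 mulmx1 subrr.
Qed.

Lemma frame_kernel (w : 'rV[R]_n) : w *m B^T = 0 -> (w <= L)%MS.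
Proof.
move=> wB; rewrite -[w]mulmx1 -frame_complete mulmxDr mulmxA wB mul0mx add0r.
by have [_ <-] := oB'; rewrite mulmxA submxMl.
Qed.

Lemma frame_fixed (w : 'rV[R]_n) : (w <= L)%MS -> w *m B^T = 0 /\ w *m B'^T *m B' = w.
Proof.
move=> wL; have wB : w *m B^T = 0.
  have [_ B'L] := oB'; move: wL; rewrite -B'L => /submxP[E ->].
  by rewrite -mulmxA orth_frames mulmx0.
split=> //; rewrite -[RHS]mulmx1 -frame_complete mulmxDr !mulmxA wB.
by rewrite mul0mx add0r.
Qed.

End orthonormal_frames.

(** The product of the two volumes is the volume of the orthogonal sum of the
    shadow of [K] and of the face of [P]. This sum is the image of the slab under
    the matrix [W] whose rows are the [z j] for [j \in J] and the projections of
    the other [z j] to the orthogonal complement; [W] has the same determinant as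
    [Z] up to sign. *)
Theorem bound_term p q n (e : (p + q)%N = n) (z : 'I_n -> 'rV[R]_n) (J : {set 'I_n})
    (K : set 'rV[R]_n) (B : 'M[R]_(p, n)) (B' : 'M[R]_(q, n)) :
  let Z := \matrix_j z j in let L := lin_hull J z in
  compact K -> Z \in unitmx ->
  orthonormal_basis (orth_compl L) B -> orthonormal_basis L B' ->
  (leb [set s | orth_proj (orth_compl L) K (s *m B)] *
   leb [set u | segment_sum J z (u *m B')] =
   `|\det Z|%:E * leb (slab [set t | K (t *m Z)%R] finset.set0 J))%E.
Proof.
case: n / e z J K B B' => z J K B B' Z L cK uZ oB oB'.
pose D : 'M[R]_(p + q) := diag_mx (\row_j (j \in J)%:R).
have LE : (L :=: D *m Z)%MS by exact: lin_hullE.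
have DD : D *m D = D by exact: diag_set_idem.
have inL (c : 'rV[R]_(p + q)) : (c *m D *m Z <= L)%MS by rewrite LE -mulmxA submxMl.
have DZB : D *m Z *m B^T = 0.
  apply/row_matrixP => i; rewrite row0 !rowE !mulmxA.
  by have [] := frame_fixed oB oB' (inL (delta_mx 0 i)).
have DZB' : D *m Z *m B'^T *m B' = D *m Z.
  apply/row_matrixP => i; rewrite !rowE !mulmxA.
  by have [] := frame_fixed oB oB' (inL (delta_mx 0 i)).
have [B1 _] := oB; have [B'1 _] := oB'.
have B'B := orth_frames oB oB'.
have BB' : B *m B'^T = 0 by rewrite -[LHS]trmxK trmx_mul trmxK B'B trmx0.
(* [N Z] is the part removed by projecting, hence a combination of the [z j],
   [j \in J], which gives [N D = N]. *)
pose N := (1%:M - D) *m Z *m B'^T *m B' *m invmx Z.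
have DN : D *m N = 0.
  by rewrite /N !mulmxA mulmxBr mulmx1 DD subrr !mul0mx.
have ND : N *m D = N.
  have /submxP[E NE] : (N *m Z <= D *m Z)%MS.
    by rewrite /N mulmxKV// -LE; have [_ <-] := oB'; rewrite submxMl.
  have {}NE : N = E *m D by rewrite -[N](mulmxK uZ) NE mulmxA mulmxK.
  by rewrite NE -mulmxA DD.
pose W := (1%:M - N) *m Z.
have WE : W = D *m Z + (1%:M - D) *m Z *m B^T *m B.
  have ZE : Z = D *m Z + (1%:M - D) *m Z by rewrite -mulmxDl addrC subrK mul1mx.
  rewrite /W mulmxBl mul1mx /N mulmxKV// [X in X - _]ZE -addrA; congr (_ + _).
  rewrite -[X in X - _]mulmx1 -(frame_complete oB oB').
  by rewrite mulmxDr !mulmxA addrK.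
have dW : `|\det W| = `|\det Z| by rewrite det_mulmx normrM (det_unipotent DD DN ND) mul1r.
clearbody W.
have WB : W *m B^T = (1%:M - D) *m Z *m B^T.
  by rewrite WE (mulmxDl (D *m Z)) DZB add0r -!mulmxA B1 mulmx1.
have WB' : W *m B'^T *m B' = D *m Z.
  by rewrite WE (mulmxDl (D *m Z)) -(mulmxA _ B) BB' mulmx0 addr0 DZB'.
set A1 := [set s | _]; set A2 := [set u | _].
have mA1 : row_measurable A1.
  rewrite /A1 orth_proj_frame//; apply: compact_row_measurable.
  by apply: compact_image => //; exact: mulmxr_row_continuous.
have mA2 : row_measurable A2.
  apply: row_measurable_mul; apply: compact_row_measurable.
  rewrite segment_sumE (_ : image _ _ = (fun c => c *m (D *m Z)) @` unit_cube).
    apply: compact_image; first exact: mulmxr_row_continuous.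
    exact: compact_unit_cube.
  by apply/seteqP; split=> _ [c c01 <-]; exists c; rewrite ?mulmxA.
rewrite -leb_prod//.
pose C := col_mx B B'.
have uWC : W *m C^T \in unitmx.
  rewrite unitmxE unitfE -normr_gt0 det_mulmx normrM (det_frame oB oB') mulr1 dW.
  by rewrite normr_gt0 -unitfE -unitmxE.
rewrite (unitmx_scales_leb uWC); last first.
  rewrite (_ : mkset _ = [set x | A1 (x *m lsubmx 1%:M)] `&` [set x | A2 (x *m rsubmx 1%:M)]).
    by apply: row_measurableI; exact: row_measurable_mul.
  by apply/seteqP; split=> x /=; rewrite mulmx_lsub mulmx_rsub !mulmx1.
rewrite det_mulmx normrM (det_frame oB oB') mulr1 dW.
congr (_ * leb _)%E; apply/funext => t; apply/propext.
rewrite /= tr_col_mx mul_mx_row mul_mx_row row_mxKl row_mxKr.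
rewrite /A1 orth_proj_frame// /A2 /= segment_sumE !mulmxA.
have -> : t *m W *m B'^T *m B' = t *m D *m Z by rewrite -!mulmxA (mulmxA W) WB' mulmxA.
have -> : t *m W *m B^T = t *m (1%:M - D) *m Z *m B^T by rewrite -!mulmxA WB !mulmxA.
split=> [[[x Kx xt] [c c01 cE]]|[k Kk kt]].
  pose k := x *m invmx Z.
  have xk : x = k *m Z by rewrite mulmxKV.
  have cD j : j \in J -> c 0 j = t 0 j.
    move=> jJ; have /(can_inj (mulmxK uZ))/rowP/(_ j) := cE.
    by rewrite !mul_diag_set jJ.
  exists k; first by rewrite /= -xk.
  move=> j; case: ifP => jJ; first by rewrite -cD.
  rewrite finset.in_set0.
  have wB : (t *m (1%:M - D) - k *m (1%:M - D)) *m Z *m B^T = 0.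
    rewrite !mulmxBl -xt {1}xk; apply/eqP; rewrite subr_eq0; apply/eqP.
    rewrite mulmxBr mulmx1 !mulmxBl -[X in _ - X]mulmxA.
    by rewrite -(mulmxA _ Z) -(mulmxA k) (mulmxA D) DZB mulmx0 subr0.
  have := frame_kernel oB oB' wB; rewrite LE => /submxP[E].
  rewrite mulmxA => /(can_inj (mulmxK uZ))/rowP/(_ j).
  rewrite -mulmxBl mulmxBr mulmx1 [LHS]mxE [X in _ + X]mxE !mul_diag_set jJ subr0 mxE.
  by move=> /eqP; rewrite [X in _ + X]mxE subr_eq0 => /eqP.
split.
  exists (k *m Z) => //.
  have <- : k *m (1%:M - D) = t *m (1%:M - D).
    rewrite !mulmxBr !mulmx1; apply/rowP => j.
    rewrite [LHS]mxE [RHS]mxE [X in _ + X = _]mxE [X in _ = _ + X]mxE !mul_diag_set.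
    by have := kt j; case: ifP; rewrite ?subrr// finset.in_set0 => _ ->.
  rewrite mulmxBr mulmx1 !mulmxBl -(mulmxA k D Z) -(mulmxA k (D *m Z)) DZB.
  by rewrite mulmx0 subr0.
exists (\row_j if j \in J then t 0 j else 0).
  by move=> j; rewrite mxE; have := kt j; case: ifP; rewrite ?lexx ?ler01.
congr (_ *m _); apply/rowP => j; rewrite !mul_diag_set.
by case: ifP => // jJ; rewrite mxE jJ.
Qed.

End bound_terms.

(** * The bound as the volume of a thickened body *)

Section bound_value.
Context {R : realType}.
Local Notation T := (measurableTypeR R).
Local Notation mu1 := (@lebesgue_measure R).

Lemma coord_set_compact n (K : set 'rV[R]_n) (Z : 'M[R]_n) : Z \in unitmx ->
  compact K -> compact [set t | K (t *m Z)].
Proof.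
move=> uZ cK; rewrite (_ : mkset _ = (fun x => x *m invmx Z) @` K).
  by apply: compact_image => //; exact: mulmxr_row_continuous.
apply/seteqP; split=> [t Kt|_ [x Kx <-]]; last by rewrite /= mulmxKV.
by exists (t *m Z) => //; rewrite mulmxK.
Qed.

Lemma coord_set_cvx n (K : set 'rV[R]_n) (Z : 'M[R]_n) :
  cvx K -> cvx [set t | K (t *m Z)].
Proof. by move=> vK x y t t0 t1 Kx Ky; rewrite /= mulmxDl -!scalemxAl; exact: vK. Qed.

(** Both sides are the volume of [K + P]; on the right it is computed in the
    coordinates given by the [z j]. *)
Theorem bound_eq_leb n (K : set 'rV[R]_n) (z : 'I_n -> 'rV[R]_n) :
  compact K -> cvx K -> row_free (\matrix_j z j) ->
  (\sum_(i < n.+1) \sum_(J : {set 'I_n} | #|J| == i)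
    vol (n - i) (orth_compl (lin_hull J z))
      (orth_proj (orth_compl (lin_hull J z)) K) *
    vol i (lin_hull J z) (segment_sum J z) =
  `|\det (\matrix_j z j)|%:E *
    leb (minkowski_sum [set t | K (t *m \matrix_j z j)%R] unit_cube))%E.
Proof.
move=> cK vK fz; have uZ : \matrix_j z j \in unitmx by rewrite -row_free_unit.
rewrite leb_cube_sum_slabs; [|exact: coord_set_compact|exact: coord_set_cvx].
rewrite ge0_sume_distrr; last by move=> J _; exact: leb_ge0.
rewrite [RHS](partition_big (fun J : {set 'I_n} => inord #|J| : 'I_n.+1) xpredT)//=.
apply: eq_bigr => i _; apply: eq_big => [J|J /eqP Ji].
  by rewrite -val_eqE/= inordK// ltnS -[X in (_ <= X)%N]card_ord max_card.
have rL : \rank (lin_hull J z) = i by rewrite rank_lin_hull.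
have rL' : \rank (orth_compl (lin_hull J z)) = (n - i)%N by rewrite rank_orth_compl rL.
have [B' oB' ->] := vol_orthonormal rL; have [B oB ->] := vol_orthonormal rL'.
by apply: bound_term => //; rewrite subnK// -ltnS.
Qed.

Definition coord_box n (A : set R) : set 'rV[R]_n := [set x : 'rV[R]_n | forall j, A (x 0 j)].

Lemma coord_box_measurable n (A : set T) : measurable A -> row_measurable (@coord_box n A).
Proof.
move=> mA; rewrite row_measurableE.
rewrite (_ : tuple_of_row_set _ = \bigcap_(j in [set: 'I_n])
    (fun t : n.-tuple T => tnth t j) @^-1` A).
  apply: fin_bigcap_measurable => // j _; rewrite -[X in measurable X]setTI.
  exact: measurable_tnth.
apply/seteqP; split=> [t At j _|t At j]; first by have := At j; rewrite mxE.
by rewrite mxE; exact: At.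
Qed.

Lemma leb_coord_box n (A : set T) : measurable A -> mu1 A = 1%E -> leb (@coord_box n A) = 1%E.
Proof.
move=> mA A1; elim: n => [|n IH].
  by rewrite /leb/= diracE mem_set// => -[].
rewrite lebE1 (eq_integral (fun x : T => (\1_A x)%:E)).
  by rewrite integral_indic// setIT.
move=> x _; rewrite indicE; have [xA|xA] := boolP (x \in A).
  rewrite -IH; congr leb; apply/seteqP; split=> y Ay j.
    by have := Ay (lift ord0 j); rewrite cons_rowS.
  have [k ->|->] := unliftP ord0 j; first by rewrite cons_rowS; exact: Ay.
  by rewrite cons_row0; exact: set_mem.
rewrite (_ : [set y | _] = set0) ?leb0//; apply/seteqP; split=> // y /(_ ord0).
by rewrite cons_row0 => /mem_set; rewrite (negbTE xA).
Qed.

Lemma unit_cubeE n : @unit_cube R n = coord_box `[0, 1]%classic.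
Proof.
by apply/funext => x; apply/propext; split=> h j; have := h j; rewrite /= in_itv.
Qed.

(** Half-open, so that its integer translates tile the space without overlap. *)
Definition half_cube n : set 'rV[R]_n := coord_box `[0, 1[%classic.

Lemma half_cube_measurable n : row_measurable (@half_cube n).
Proof. exact: coord_box_measurable. Qed.

Lemma leb_half_cube n : leb (@half_cube n) = 1%E.
Proof. by apply: leb_coord_box => //; rewrite lebesgue_measure_itv/= lte_fin ltr01 oppr0 adde0. Qed.

Lemma unit_cube_measurable n : row_measurable (@unit_cube R n).
Proof. by rewrite unit_cubeE; exact: coord_box_measurable. Qed.

Lemma leb_unit_cube n : leb (@unit_cube R n) = 1%E.
Proof.
rewrite unit_cubeE; apply: leb_coord_box => //.
by rewrite lebesgue_measure_itv/= lte_fin ltr01 oppr0 adde0.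
Qed.

Lemma leb_ball_gt0 n (x : 'rV[R]_n) (e : R) : 0 < e -> (0 < leb (ball x e))%E.
Proof.
move=> e0; have d0 : e / 2 != 0 by rewrite gt_eqF// divr_gt0.
have uA : (e / 2)%:M \in @unitmx R n by rewrite unitmxE det_scalar unitrX// unitfE.
have mB : row_measurable (ball x e) by apply: open_row_measurable; exact: ball_open.
rewrite -(leb_translate x mB).
rewrite (unitmx_scales_leb uA); last exact: row_measurable_translate.
rewrite mule_gt0//.
  by rewrite lte_fin det_scalar normr_gt0 expf_eq0 negb_and d0 orbT.
apply: (@lt_le_trans _ _ 1%E) => //; rewrite -(leb_half_cube n); apply: le_leb.
- exact: half_cube_measurable.
- exact: (row_measurable_mul _ (row_measurable_translate _ mB)).
move=> y yc; apply/(mx_ballP _ _ e0) => j.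
rewrite mul_mx_scalar !mxE; have := yc j; rewrite /= in_itv/= => /andP[y0 y1].
rewrite opprD addrC subrK normrN ger0_norm; last by rewrite mulr_ge0// ltW// divr_gt0.
rewrite mulrAC ltr_pdivrMr// ltr_pM2l//.
by apply: lt_trans y1 _; lra.
Qed.

End bound_value.

(** * Counting integer points with unit cells *)

Section integer_points.
Context {R : realType}.

Definition emb n (a : 'rV[int]_n) : 'rV[R]_n := map_mx (fun x : int => x%:~R) a.

Definition int_points n (X : set 'rV[R]_n) : set 'rV[int]_n := [set a | X (emb a)].

Lemma embE n (a : 'rV[int]_n) j : emb a 0 j = (a 0 j)%:~R.
Proof. by rewrite mxE. Qed.

Lemma emb_inj n : injective (@emb n).
Proof.
by move=> a b /rowP ab; apply/rowP => j; have := ab j; rewrite !embE => /intr_inj.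
Qed.

Lemma embD n (a b : 'rV[int]_n) : emb (a + b) = emb a + emb b.
Proof. by apply/rowP => j; rewrite !mxE rmorphD. Qed.

Lemma emb_mul n m (a : 'rV[int]_n) (M : 'M[int]_(n, m)) :
  emb (a *m M) = emb a *m map_mx (fun x : int => x%:~R) M.
Proof. exact: map_mxM. Qed.

Lemma compact_coord_bound n (X : set 'rV[R]_n) : compact X ->
  exists N : nat, forall x, X x -> forall j, `|x 0 j| <= N%:R.
Proof.
move=> /compact_bounded[M [Mreal XM]].
exists (`|archimedean.Num.ceil (M + 1)|)%N => x Xx j.
have h : `|x| <= M + 1 by apply: XM => //; rewrite ltrDl.
have xj : `|x 0 j| <= `|x|.
  rewrite [leRHS]/Num.norm /= mx_normrE.
  by apply/bigmax_geP; right => /=; exists (0, j).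
apply: le_trans xj _; apply: le_trans h _.
apply: le_trans (archimedean.Num.Theory.ceil_ge _) _.
by rewrite natr_absz ler_int ler_norm.
Qed.

Lemma finite_int_points n (X : set 'rV[R]_n) : compact X -> finite_set (int_points X).
Proof.
move=> /compact_coord_bound[N XN].
pose f (g : {ffun 'I_n -> 'I_(N + N).+1}) : 'rV[int]_n := \row_j ((g j)%:Z - N%:Z).
apply: (@sub_finite_set _ _ (range f)); last exact: finite_image.
move=> a Xa.
have aN j : `|a 0 j| <= N%:Z.
  by have := XN _ Xa j; rewrite embE -intr_norm pmulrn ler_int.
exists [ffun j => inord `|(a 0 j + N%:Z)%R|%N] => //.
apply/rowP => j; rewrite mxE ffunE; have := aN j; rewrite ler_norml => /andP[h1 h2].
rewrite inordK; first lia.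
lia.
Qed.

Lemma countingE (T : choiceType) (A : set T) : finite_set A ->
  counting A = (#|` fset_set A|)%:R%:E :> \bar R.
Proof. by move=> fA; rewrite /counting asboolT. Qed.

Lemma counting_image_le (T U : choiceType) (f : T -> U) (A : set U) (B : set T) :
  finite_set B -> A `<=` f @` B -> (counting A <= counting B :> \bar R)%E.
Proof.
move=> fB AB; have fi : finite_set (f @` B) by exact: finite_image.
have fA : finite_set A by exact: sub_finite_set AB fi.
rewrite !countingE// lee_fin ler_nat.
have AfB : (fset_set A `<=` fset_set (f @` B))%fset by rewrite -(fset_set_sub fA fi).
apply: leq_trans (fsubset_leq_card AfB) _.
rewrite fset_set_image//; exact: leq_imfset_card.
Qed.

Lemma counting_bigcup_le (T U : choiceType) (s : seq T) (F : T -> set U) :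
  (forall i, finite_set (F i)) ->
  (counting (\bigcup_(i in [set` s]) F i) <= \sum_(i <- s) counting (F i) :> \bar R)%E.
Proof.
move=> fF.
have fU (r : seq T) : finite_set (\bigcup_(i in [set` r]) F i).
  by apply: bigcup_finite; [exact: finite_seq|move=> i _; exact: fF].
elim: s => [|i s IH]; first by rewrite bigcup_seq !big_nil countingE// fset_set0.
rewrite bigcup_cons big_cons; apply: le_trans (leeD2l _ IH).
rewrite !countingE//; last by rewrite finite_setU.
by rewrite -EFinD lee_fin -natrD ler_nat fset_setU// cardfsU leq_subr.
Qed.

Lemma int_cube_uniq (x : R) (a b : int) :
  a%:~R <= x < a%:~R + 1 -> b%:~R <= x < b%:~R + 1 -> a = b.
Proof.
move=> /andP[ax xa] /andP[bx xb].
have : a%:~R < (b + 1)%:~R :> R by rewrite rmorphD/=; apply: le_lt_trans ax _.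
have : b%:~R < (a + 1)%:~R :> R by rewrite rmorphD/=; apply: le_lt_trans bx _.
by rewrite !ltr_int; lia.
Qed.

Definition cell n (a : 'rV[int]_n) : set 'rV[R]_n := [set x | half_cube (x - emb a)].

Lemma cellP n (a : 'rV[int]_n) x : cell a x <-> forall j, (a 0 j)%:~R <= x 0 j < (a 0 j)%:~R + 1.
Proof.
rewrite /cell/=; split=> h j; have := h j; rewrite /= !mxE in_itv/=.
  by move=> /andP[? ?]; apply/andP; split; lra.
by move=> /andP[? ?]; apply/andP; split; lra.
Qed.

Lemma cell_uniq n (a b : 'rV[int]_n) x : cell a x -> cell b x -> a = b.
Proof.
move=> /cellP ax /cellP bx; apply/rowP => j.
exact: int_cube_uniq (ax j) (bx j).
Qed.

Lemma cell_measurable n (a : 'rV[int]_n) : row_measurable (cell a).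
Proof. by apply: row_measurable_translate; exact: half_cube_measurable. Qed.

Lemma leb_cell n (a : 'rV[int]_n) : leb (cell a) = 1%E.
Proof. by rewrite leb_translate ?leb_half_cube//; exact: half_cube_measurable. Qed.

(** The half-open unit cells at the integer points of [X] are disjoint and lie
    in [X + unit_cube]; [W] records the room they leave. *)
Lemma counting_room_le n (X W : set 'rV[R]_n) : compact X -> row_measurable W ->
  W `<=` minkowski_sum X unit_cube ->
  (forall a x, X (emb a) -> W x -> ~ cell a x) ->
  (counting (int_points X) + leb W <= leb (minkowski_sum X unit_cube))%E.
Proof.
move=> cX mW WX disj; have fS := finite_int_points cX.
have := @leb_bigcup R n _ _ (@cell_measurable n) (fset_set (int_points X)) (fset_uniq _).
rewrite fset_setK// => lebS.
have {}lebS : leb (\bigcup_(a in int_points X) cell a) = counting (int_points X).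
  rewrite lebS; last by move=> a b _ _ [x [ax bx]]; exact: cell_uniq ax bx.
  rewrite countingE// (eq_bigr (fun=> (1 : R)%:E)); last by move=> a _; exact: leb_cell.
  rewrite sumEFin; congr EFin.
  by rewrite big_const_seq count_predT iter_addr addr0.
have mU : row_measurable (\bigcup_(a in int_points X) cell a).
  have := @row_measurable_bigcup R n _ _ (@cell_measurable n) (fset_set (int_points X)).
  by rewrite fset_setK.
rewrite -lebS -lebU//.
  apply: le_leb; first exact: row_measurableU.
    by apply: compact_row_measurable; exact: compact_cube_sum.
  move=> x [[a Xa ax]|/WX//]; exists (emb a) => //; exists (x - emb a).
    by move=> j; have := ax j; rewrite /= in_itv/= => /andP[-> /ltW].
  by rewrite addrC subrK.
by apply/seteqP; split=> // x [[a Xa ax] Wx]; exact: (disj a x Xa Wx ax).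
Qed.

Lemma counting_le_leb n (X : set 'rV[R]_n) : compact X ->
  (counting (int_points X) <= leb (minkowski_sum X unit_cube))%E.
Proof.
move=> cX; have := @counting_room_le n X set0 cX (@row_measurable0 R n).
by rewrite leb0 adde0; apply.
Qed.

End integer_points.

(** Representatives come from the Smith normal form [M = L D N]: dividing the
    coordinates of [y N^-1] by the diagonal entries [e i] of [D] leaves
    [\prod_i |e i| = |det M|] possible remainders. *)
Lemma coset_representatives n (M : 'M[int]_n) : \det M != 0 ->
  exists s : seq 'rV[int]_n, [/\ size s = `|\det M|%N, 0 \in s &
    forall y, exists2 r, r \in s & exists a, y = a *m M + r].
Proof.
have [L uL [N uN [d _ ME]]] := int_Smith_normal_form M.
pose e (i : 'I_n) : int := d`_i.
pose D := \matrix_(i < n, j < n) (e i *+ (i == j :> nat)).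
have DE : D = diag_mx (\row_i e i) by apply/matrixP => i j; rewrite !mxE.
have detE : `|\det M|%N = (\prod_(i < n) absz (e i))%N.
  rewrite ME !det_mulmx -/D DE det_diag !abszM.
  have unit1 (A : 'M[int]_n) : A \in unitmx -> `|\det A|%N = 1%N.
    move=> uA; have := congr1 (fun B => `|\det B|%N) (mulmxV uA).
    by rewrite det_mulmx det1 abszM => /eqP; rewrite muln_eq1 => /andP[/eqP].
  rewrite !unit1// mul1n muln1.
  rewrite (big_morph absz abszM (erefl _ : `|1|%N = 1%N)).
  by apply: eq_bigr => i _; rewrite mxE.
rewrite -absz_eq0 detE => d0.
have {}d0 (i : 'I_n) : (0 < absz (e i))%N.
  by rewrite lt0n; apply: contra d0 => di; apply/eqP/eqP; rewrite (bigD1 i)//= (eqP di) mul0n.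
pose rep (g : {dffun forall i : 'I_n, 'I_(absz (e i))}) : 'rV[int]_n :=
  (\row_i (g i : nat)%:Z) *m N.
exists [seq rep g | g : {dffun forall i : 'I_n, 'I_(absz (e i))}]; split.
- by rewrite size_image card_dep_ffun foldrE big_map big_enum/=; apply: eq_bigr => i _;
    rewrite card_ord.
- apply/mapP; exists [ffun i => Ordinal (d0 i)]; first by rewrite mem_enum.
  rewrite /rep (_ : \row_i _ = 0) ?mul0mx//.
  by apply/rowP => i; rewrite !mxE ffunE.
move=> y; pose u := y *m invmx N.
have lt_mod i : (absz (u 0%R i %% e i)%Z < absz (e i))%N.
  have di0 : e i != 0 by rewrite -absz_gt0.
  by rewrite -ltz_nat gez0_abs ?modz_ge0// ltz_mod.
exists (rep [ffun i => Ordinal (lt_mod i)]); first by apply: map_f; rewrite mem_enum.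
exists ((\row_i (u 0%R i %/ e i)%Z) *m invmx L).
rewrite /rep ME -/D !mulmxA mulmxKV// -mulmxDl -[LHS](mulmxKV uN) -/u.
congr (_ *m _); clearbody u.
apply/rowP => i; rewrite DE mul_mx_diag !mxE ffunE/=.
have di0 : e i != 0 by rewrite -absz_gt0.
by rewrite gez0_abs ?modz_ge0// -divz_eq.
Qed.

(** * Convex bodies filled by unit cells *)

Section tight_bodies.
Context {R : realType}.

Definition int_box n (a b : 'rV[int]_n) : set 'rV[R]_n :=
  [set t : 'rV[R]_n | forall j, (a 0 j)%:~R <= t 0 j <= (b 0 j)%:~R].

Lemma finite_set_argmin (T : eqType) (A : set T) (f : T -> int) :
  finite_set A -> A !=set0 -> exists2 y, A y & forall x, A x -> f y <= f x.
Proof.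
move=> /finite_seqP[s ->]; elim: s => [|x s IH]; first by move=> [].
move=> _; have [/IH[y sy ymin]|s0] := pselect ([set` s] !=set0); last first.
  exists x; first by rewrite /= mem_head.
  move=> w; rewrite /= in_cons => /orP[/eqP ->//|ws].
  by exfalso; apply: s0; exists w.
have [xy|/ltW yx] := leP (f x) (f y).
  exists x; first by rewrite /= mem_head.
  by move=> w; rewrite /= in_cons => /orP[/eqP ->//|/ymin]; exact: le_trans.
exists y; first by rewrite /= in_cons (sy : y \in s) orbT.
by move=> w; rewrite /= in_cons => /orP[/eqP ->//|/ymin].
Qed.

(** By induction on the number of coordinates that are not extreme: a point is on
    the segment between the two points where one such coordinate is pushed to its
    extreme values. *)
Lemma box_from_vertices n (X : set 'rV[R]_n) (a b : 'rV[R]_n) : cvx X ->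
  (forall v : 'rV[R]_n, (forall j, v 0 j = a 0 j \/ v 0 j = b 0 j) -> X v) ->
  forall t : 'rV[R]_n, (forall j, a 0 j <= t 0 j <= b 0 j) -> X t.
Proof.
move=> vX Xv t tab.
suff H (r : seq 'I_n) (u : 'rV[R]_n) :
    (forall j, if j \in r then is_true (a 0 j <= u 0 j <= b 0 j)
               else u 0 j = a 0 j \/ u 0 j = b 0 j) -> X u.
  apply: (H (enum 'I_n)) => j.
  by have -> : j \in enum 'I_n by rewrite mem_enum.
elim: r u => [|i r IH] u uab; first exact: Xv.
have [ir|ir] := boolP (i \in r).
  by apply: IH => j; have := uab j; rewrite in_cons; case: eqP => [->|_] /=; rewrite ?ir.
pose ua : 'rV[R]_n := \row_j if j == i then a 0 j else u 0 j.
pose ub : 'rV[R]_n := \row_j if j == i then b 0 j else u 0 j.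
have Xa : X ua.
  apply: IH => j; have := uab j; rewrite in_cons mxE; case: eqP => //= -> _.
  by rewrite (negbTE ir); left.
have Xb : X ub.
  apply: IH => j; have := uab j; rewrite in_cons mxE; case: eqP => //= -> _.
  by rewrite (negbTE ir); right.
have := uab i; rewrite mem_head => /andP[au ub'].
have [abi|abi] := eqVneq (a 0 i) (b 0 i).
  have -> : u = ua by apply/rowP => j; rewrite mxE; case: eqP => // ->; apply/eqP;
    rewrite eq_le au abi ub'.
  by [].
have ltab : 0 < b 0 i - a 0 i by rewrite subr_gt0 lt_neqAle abi (le_trans au).
pose t' := (u 0 i - a 0 i) / (b 0 i - a 0 i).
have -> : u = (1 - t') *: ua + t' *: ub.
  apply/rowP => j; rewrite !mxE; case: eqP => [->|_]; last by rewrite -mulrDl subrK mul1r.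
  by rewrite /t'; field; rewrite gt_eqF.
apply: vX => //; first by apply: divr_ge0; [rewrite subr_ge0|exact: ltW].
by rewrite ler_pdivrMr// mul1r lerD2r.
Qed.

Section tight.
Variables (n : nat) (X : set 'rV[R]_n).
Hypotheses (cX : compact X) (vX : cvx X).
Hypothesis tightX : counting (int_points X) = leb (minkowski_sum X unit_cube).

(** Room left by the cells, such as a ball, would make the inequality strict. *)
Lemma tight_cells_dense (p0 : 'rV[R]_n) (d : R) : 0 < d ->
  ball p0 d `<=` minkowski_sum X unit_cube ->
  exists p a, [/\ ball p0 d p, int_points X a & cell a p].
Proof.
move=> d0 sub; apply: contrapT => H.
have mW : row_measurable (ball p0 d) by apply: open_row_measurable; exact: ball_open.
have disj a x : X (emb a) -> ball p0 d x -> ~ cell a x.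
  by move=> Xa dx ax; apply: H; exists x, a.
have := counting_room_le cX mW sub disj.
rewrite -tightX countingE; last exact: finite_int_points.
have := leb_ball_gt0 p0 d0; case: (leb _) => [r| |]// r0.
  by rewrite -EFinD lee_fin gerDl leNgt => /negP; apply.
Qed.

(** Pushing the cell of [x] slightly towards [y] makes it stick out across its
    facet in direction [i]; by density the cell behind that facet is present. *)
Lemma tight_step (x y : 'rV[int]_n) i : int_points X x -> int_points X y ->
  x 0 i != y 0 i -> exists2 a, int_points X a &
    forall j, a 0 j = if j == i then (if x 0 i < y 0 i then x 0 i + 1 else x 0 i - 1)
                      else x 0 j.
Proof.
move=> Sx Sy xyi.
(* The step [e] changes no coordinate by more than 1/4, so the other coordinates
   stay inside the cell; the radius [d] is small enough for the whole ball to be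
   across the facet, because [i] moves by at least [e = 2 d]. *)
pose H : R := 1 + \sum_j `|(y 0 j - x 0 j)%:~R|.
have H1 : 1 <= H by rewrite lerDl sumr_ge0.
have H0 : 0 < H by apply: lt_le_trans H1.
pose e : R := (4 * H)^-1; pose d := e / 2.
have e0 : 0 < e by rewrite invr_gt0 mulr_gt0.
have eH : e * H = 1 / 4 by rewrite /e; field; rewrite gt_eqF.
have e4 : e <= 1 / 4 by rewrite -eH ler_peMr// ltW.
have d0 : 0 < d by rewrite divr_gt0.
have dE : e = 2 * d by rewrite /d; field.
pose D j : R := e * (y 0 j - x 0 j)%:~R.
have Dle j : `|D j| <= 1 / 4.
  rewrite -eH normrM gtr0_norm// ler_pM2l//.
  rewrite /H (bigD1 j)//= addrCA lerDl addr_ge0// sumr_ge0//.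
have Di : if x 0 i < y 0 i then 2 * d <= D i else D i <= - (2 * d).
  rewrite -dE /D; case: ltP => [lxy|lyx].
    have h : 1%:~R <= (y 0 i - x 0 i)%:~R :> R by rewrite ler_int; lia.
    by rewrite ler_peMr// ltW.
  have h : (y 0 i - x 0 i)%:~R <= (- 1)%:~R :> R.
    by rewrite ler_int; move: xyi lyx; lia.
  by rewrite -[X in _ <= X]mulrN1 ler_pM2l.
clearbody d; clearbody e.
pose s := (1 - e) *: emb x + e *: emb y : 'rV[R]_n.
have Xs : X s by apply: vX => //; [exact: ltW|apply: le_trans e4 _; lra].
have sE j : s 0 j = (x 0 j)%:~R + D j.
  by rewrite /s /D !mxE rmorphB/=; ring.
clearbody s; clearbody D.
pose c : 'rV[R]_n := \row_j if j == i then (if x 0 i < y 0 i then 1 - d else d) else 1 / 2.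
have sub : ball (s + c) d `<=` minkowski_sum X unit_cube.
  move=> p /(mx_ballP _ _ d0) pd; exists s => //; exists (p - s); last by rewrite addrC subrK.
  move=> j; have := pd j; rewrite !mxE ltr_norml => /andP[].
  by case: eqP => _; [case: (ltP (x 0 i) (y 0 i)) => _|]; move=> ? ?; apply/andP; split; lra.
have [p [a [/(mx_ballP _ _ d0) pd Sa /cellP ap]]] := tight_cells_dense d0 sub.
exists a => // j; apply: int_cube_uniq (ap j) _.
have := pd j; have := Dle j; rewrite !mxE sE ler_norml ltr_norml => /andP[? ?] /andP[].
have [->|_] := eqVneq j i; last by move=> ? ?; apply/andP; split; lra.
move: Di (Dle i); rewrite ler_norml => + /andP[].
by case: (ltP (x 0 i) (y 0 i)) => _ ? ? ? ? ?; rewrite ?rmorphD ?rmorphB/=;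
  apply/andP; split; lra.
Qed.

(** Repeated unit steps bring a single coordinate of [x] to its value in [y]. *)
Lemma tight_coord (x y : 'rV[int]_n) i : int_points X x -> int_points X y ->
  exists2 a, int_points X a & forall j, a 0 j = if j == i then y 0 i else x 0 j.
Proof.
move=> + Sy; have [k] := ubnP `|(y 0 i - x 0 i)%R|%N; elim: k x => // k IH x kxy Sx.
have [xy|xy] := eqVneq (x 0 i) (y 0 i).
  by exists x => // j; case: eqP => // ->.
have [w Sw wE] := tight_step Sx Sy xy.
have [|a Sa aE] := IH w _ Sw.
  by rewrite wE eqxx; move: kxy xy; case: ltP => ?; lia.
by exists a => // j; rewrite aE wE; case: eqP.
Qed.

Lemma tight_mix (x v : 'rV[int]_n) : int_points X x ->
  (forall i, exists2 y, int_points X y & y 0 i = v 0 i) -> int_points X v.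
Proof.
move=> Sx Sv.
suff [a Sa aE] : exists2 a, int_points X a &
    forall j, a 0 j = if j \in enum 'I_n then v 0 j else x 0 j.
  by have <- : a = v by apply/rowP => j; rewrite aE mem_enum.
elim: (enum 'I_n) => [|i r [a Sa aE]]; first by exists x.
have [y Sy yi] := Sv i; have [w Sw wE] := tight_coord i Sa Sy.
exists w => // j; rewrite wE in_cons; case: eqP => [->|_]; first by rewrite yi.
exact: aE.
Qed.

(** The ball is centred in [k + unit_cube] next to its upper or lower facet in
    direction [i], so some integer point of [X] is nearly as extreme as [k]. *)
Lemma tight_escape (k : 'rV[R]_n) i (up : bool) (d : R) : X k -> 0 < d -> d <= 1 / 4 ->
  exists p a, [/\ int_points X a, cell a p &
    if up then k 0 i + 1 - 2 * d < p 0 i else p 0 i < k 0 i + 2 * d].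
Proof.
move=> Xk d0 d4.
pose c : 'rV[R]_n := \row_j if j == i then (if up then 1 - d else d) else 1 / 2.
have sub : ball (k + c) d `<=` minkowski_sum X unit_cube.
  move=> p /(mx_ballP _ _ d0) pd; exists k => //; exists (p - k); last by rewrite addrC subrK.
  move=> j; have := pd j; rewrite !mxE ltr_norml => /andP[].
  by case: eqP => _; [case: up {c pd}|]; move=> ? ?; apply/andP; split; lra.
have [p [a [/(mx_ballP _ _ d0) pd Sa ap]]] := tight_cells_dense d0 sub.
exists p, a; split=> //; have := pd i; rewrite !mxE eqxx ltr_norml => /andP[].
by case: up {c sub pd}; lra.
Qed.

(** The coordinates of the integer points of [X] can be combined freely, so every
    vertex of their bounding box lies in [X], and [X] cannot leave this box. *)
Theorem tight_int_box : X !=set0 -> exists a b, X = int_box a b.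
Proof.
move=> [k0 Xk0].
have fS := finite_int_points cX.
have q0 : 0 < 1 / 4 :> R by lra.
have S0 : int_points X !=set0.
  have d0 : 0 < 1 / 2 :> R by lra.
  have sub : ball (k0 + \row_j (1 / 2)) (1 / 2) `<=` minkowski_sum X unit_cube.
    move=> p /(mx_ballP _ _ d0) pd; exists k0 => //; exists (p - k0); last by rewrite addrC subrK.
    by move=> j; have := pd j; rewrite !mxE ltr_norml => /andP[? ?]; apply/andP; split; lra.
  by have [p [a [_ Sa _]]] := tight_cells_dense d0 sub; exists a.
have mn i := finite_set_argmin (fun x : 'rV[int]_n => x 0 i) fS S0.
have mx i := finite_set_argmin (fun x : 'rV[int]_n => - x 0 i) fS S0.
pose lo i := projT1 (cid2 (mn i)); pose hi i := projT1 (cid2 (mx i)).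
have Slo i : int_points X (lo i) by rewrite /lo; case: cid2.
have Shi i : int_points X (hi i) by rewrite /hi; case: cid2.
have loP i x : int_points X x -> lo i 0 i <= x 0 i by rewrite /lo; case: cid2 => /= ? _; exact.
have hiP i x : int_points X x -> x 0 i <= hi i 0 i.
  by move=> Sx; rewrite -lerN2 /hi; case: cid2 => /= ? _; exact.
pose a : 'rV[int]_n := \row_i lo i 0 i; pose b : 'rV[int]_n := \row_i hi i 0 i.
exists a, b; apply/seteqP; split=> [k Xk i|t tab].
  rewrite !mxE; apply/andP; split; rewrite leNgt; apply/negP => lt.
    pose d := Num.min (1 / 4) (((lo i 0 i)%:~R - k 0 i) / 4).
    have d0 : 0 < d by rewrite lt_min q0/= divr_gt0// subr_gt0.
    have d1 : d <= 1 / 4 by rewrite ge_min lexx.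
    have d2 : d <= ((lo i 0 i)%:~R - k 0 i) / 4 by rewrite ge_min lexx orbT.
    have [p [s [Ss /cellP/(_ i)/andP[sp _] pk]]] := tight_escape i false Xk d0 d1.
    have := loP i _ Ss; rewrite -(ler_int R) => los; lra.
  pose d := Num.min (1 / 4) ((k 0 i - (hi i 0 i)%:~R) / 4).
  have d0 : 0 < d by rewrite lt_min q0/= divr_gt0// subr_gt0.
  have d1 : d <= 1 / 4 by rewrite ge_min lexx.
  have d2 : d <= (k 0 i - (hi i 0 i)%:~R) / 4 by rewrite ge_min lexx orbT.
  have [p [s [Ss /cellP/(_ i)/andP[_ sp] pk]]] := tight_escape i true Xk d0 d1.
  have := hiP i _ Ss; rewrite -(ler_int R) => los; lra.
apply: (@box_from_vertices _ X (emb a) (emb b)) => // [v vab|j]; last first.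
  by rewrite !embE; exact: tab.
pose w : 'rV[int]_n := \row_j if v 0 j == (a 0 j)%:~R then a 0 j else b 0 j.
have -> : v = emb w.
  apply/rowP => j; rewrite embE mxE; case: eqP => // va.
  by have := vab j; rewrite !embE => -[].
have [x Sx] := S0; apply: (tight_mix Sx) => i; rewrite mxE; case: eqP => _.
  by exists (lo i) => //; rewrite mxE.
by exists (hi i) => //; rewrite mxE.
Qed.

End tight.

End tight_bodies.

(** * Cosets of the sublattice *)

Section sublattice.
Context {R : realType}.
Variables (n : nat) (M : 'M[int]_n) (K : set 'rV[R]_n).
Local Notation Z := (map_mx (fun x : int => x%:~R : R) M).
Hypotheses (cK : compact K) (uZ : Z \in unitmx).

Let K' : set 'rV[R]_n := [set t | K (t *m Z)].
(** [K'] moved so that the points of the coset of [r] become integer points. *)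
Let shift (r : 'rV[int]_n) : set 'rV[R]_n := [set t | K' (t + emb r *m invmx Z)].

Lemma lattice_countE (S : set 'rV[R]_n) : compact S ->
  lattice_count S = counting (int_points S).
Proof.
move=> cS; have fS := finite_int_points cS.
have SE : S `&` integer_lattice = @emb R n @` int_points S.
  apply/seteqP; split=> [x [Sx [a _ ax]]|_ [a Sa <-]]; last by split=> //; exists a.
  by exists a => //; rewrite /int_points/= /emb ax.
have fSE : finite_set (@emb R n @` int_points S) by exact: finite_image.
apply/eqP; rewrite eq_le /lattice_count SE; apply/andP; split.
  exact: (@counting_image_le R _ _ (@emb R n)).
apply: (@counting_image_le _ _ _ (map_mx (@archimedean.Num.floor R))) => // a Sa.
exists (emb a); first by exists a.
by apply/rowP => j; rewrite [LHS]mxE embE intrKfloor.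
Qed.

Lemma detZE : `|\det Z| = (`|\det M|%N)%:R.
Proof. by rewrite det_map_mx natr_absz intr_norm. Qed.

Lemma detM_neq0 : \det M != 0.
Proof. by move: uZ; rewrite unitmxE unitfE det_map_mx intr_eq0. Qed.

Lemma compact_coord : compact K'.
Proof. exact: coord_set_compact. Qed.

Lemma compact_shift r : compact (shift r).
Proof.
rewrite (_ : shift r = (fun x => x - emb r *m invmx Z) @` K').
  apply: compact_image; last exact: compact_coord.
  move=> x; apply: (@continuousB R _ _ id (fun=> emb r *m invmx Z)).
    exact: cvg_id.
  exact: cst_continuous.
apply/seteqP; split=> [t Kt|_ [x Kx <-]]; last by rewrite /shift/= subrK.
by exists (t + emb r *m invmx Z) => //; rewrite addrK.
Qed.

Lemma leb_shift r :
  leb (minkowski_sum (shift r) unit_cube) = leb (minkowski_sum K' unit_cube).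
Proof.
rewrite -(@leb_translate _ _ (minkowski_sum K' unit_cube) (emb r *m invmx Z)).
  congr leb; apply/seteqP; split=> [_ [x Kx [c c01 <-]]|t [x Kx [c c01 xc]]].
    by exists (x + emb r *m invmx Z) => //; exists c => //; rewrite addrAC.
  exists (x - emb r *m invmx Z); first by rewrite /shift/= subrK.
  by exists c => //; rewrite addrAC xc addrK.
by apply: compact_row_measurable; apply: compact_cube_sum; exact: compact_coord.
Qed.

Lemma shift0 : shift 0 = K'.
Proof.
apply/funext => t; rewrite /shift/=; congr K'.
by rewrite (_ : emb 0 = 0) ?mul0mx ?addr0//; apply/rowP => j; rewrite !mxE.
Qed.

Lemma shift_point (a r : 'rV[int]_n) : K (emb (a *m M + r)) <-> shift r (emb a).
Proof. by rewrite /shift /K'/= mulmxDl mulmxKV// embD emb_mul. Qed.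

Lemma counting_sum_shifts (s : seq 'rV[int]_n) :
  (forall y, exists2 r, r \in s & exists a, y = a *m M + r) ->
  (counting (int_points K) <= \sum_(r <- s) counting (int_points (shift r)) :> \bar R)%E.
Proof.
move=> sM; have fF r := finite_int_points (@compact_shift r).
pose F r := (fun a => a *m M + r) @` int_points (shift r).
have fFr r : finite_set (F r) by exact: finite_image.
apply: le_trans (le_trans (@counting_bigcup_le R _ _ s F fFr) _).
  apply: (@counting_image_le R _ _ id); last first.
    move=> y Ky; exists y => //; have [r rs [a ya]] := sM y.
    by exists r => //; exists a => //; apply/shift_point; rewrite -ya.
  by apply: bigcup_finite => // ; exact: finite_seq.
by apply: lee_sum => r _; apply: (@counting_image_le R _ _ (fun a => a *m M + r)).
Qed.

Lemma le_counting_coord :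
  (counting (int_points K) <= (`|\det Z|)%:E * leb (minkowski_sum K' unit_cube))%E.
Proof.
have [s [ss _ sM]] := coset_representatives detM_neq0.
apply: le_trans (counting_sum_shifts sM) _.
apply: (@le_trans _ _ (\sum_(r <- s) leb (minkowski_sum K' unit_cube))%E).
  apply: lee_sum => r _; rewrite -(leb_shift r); apply: counting_le_leb.
  exact: compact_shift.
rewrite big_const_seq count_predT detZE -ss.
elim: (size s) => [|k IH]; first by rewrite mul0e.
by rewrite iterS -[k.+1]addn1 natrD EFinD ge0_muleDl// ?lee_fin// mul1e addeC leeD2r.
Qed.

Hypothesis vK : cvx K.
Hypothesis K0 : K !=set0.

Lemma shift_cvx r : cvx (shift r).
Proof.
move=> x y t t0 t1 Kx Ky; rewrite /shift/=.
have -> : (1 - t) *: x + t *: y + emb r *m invmx Z =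
   (1 - t) *: (x + emb r *m invmx Z) + t *: (y + emb r *m invmx Z).
  by rewrite !scalerDr addrACA -scalerDl subrK scale1r.
have vK' := @coord_set_cvx R n K Z vK; exact: vK'.
Qed.

Lemma shift_neq0 r : shift r !=set0.
Proof.
have [x Kx] := K0; exists (x *m invmx Z - emb r *m invmx Z).
by rewrite /shift /K'/= subrK mulmxKV.
Qed.

(** There are [|det M|] cosets, none has more than [leb (K' + unit_cube)] points in
    [K], and the total is [|det M|] times this number. *)
Lemma tight_shifts (s : seq 'rV[int]_n) : size s = `|\det M|%N ->
  (forall y, exists2 r, r \in s & exists a, y = a *m M + r) ->
  counting (int_points K) = (`|\det Z|%:E * leb (minkowski_sum K' unit_cube))%E ->
  forall r, r \in s -> counting (int_points (shift r)) = leb (minkowski_sum (shift r) unit_cube).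
Proof.
move=> ss sM eqK r rs; rewrite leb_shift.
have := counting_sum_shifts sM; rewrite eqK.
have m0 : (0 < `|\det M|)%N by rewrite absz_gt0 detM_neq0.
have cle q : (counting (int_points (shift q)) <= leb (minkowski_sum K' unit_cube))%E.
  by rewrite -(leb_shift q); apply: counting_le_leb; exact: compact_shift.
have cE q := @countingE R _ _ (finite_int_points (@compact_shift q)).
have : leb (minkowski_sum K' unit_cube) \is a fin_num.
  rewrite ge0_fin_numE ?leb_ge0// ltey; apply/negP => /eqP loo.
  move: eqK; rewrite loo detZE gt0_muley ?lte_fin ?ltr0n//.
  by rewrite countingE//; exact: finite_int_points.
move: cle; case: (leb _) => // l cle _.
under eq_bigr do rewrite cE.
rewrite sumEFin -EFinM lee_fin detZE -ss => le.
apply/eqP; rewrite eq_le cle/= cE lee_fin.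
have cle' q : (#|` fset_set (int_points (shift q))|)%:R <= l :> R.
  by have := cle q; rewrite cE lee_fin.
rewrite leNgt; apply/negP => lt.
move: le; rewrite leNgt => /negP; apply.
rewrite mulr_natl -[X in _ < X](_ : \sum_(q <- s) l = _); last first.
  by rewrite big_const_seq count_predT iter_addr addr0.
rewrite (big_rem r)//= [ltRHS](big_rem r)//=.
by apply: ltr_leD => //; apply: ler_sum.
Qed.

(** Every [shift r] is a box with integer corners, in particular so is [K'] itself.
    Comparing lower corners shows that [r] has integer coordinates with respect to
    the rows of [M], so there is only one coset. *)
Theorem equality_coord :
  counting (int_points K) = (`|\det Z|%:E * leb (minkowski_sum K' unit_cube))%E ->
  (exists a b, K' = int_box a b) /\ (forall y : 'rV[int]_n, exists a, y = a *m M).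
Proof.
move=> eqK; have [s [ss s0 sM]] := coset_representatives detM_neq0.
have tight := tight_shifts ss sM eqK.
have box r : r \in s -> exists a b, shift r = int_box a b.
  move=> rs; apply: (tight_int_box (@compact_shift r) (@shift_cvx r)).
    exact: tight.
  exact: shift_neq0.
have [a0 [b0]] := box _ s0; rewrite shift0 => K'E.
split; first by exists a0, b0.
move=> y; have [r rs [a ->]] := sM y.
have [ar [br rE]] := box _ rs.
have in0 (A : set 'rV[R]_n) u v : A !=set0 -> A = int_box u v -> A (emb u).
  move=> [x Ax] AE; rewrite AE in Ax *; move=> j; rewrite embE lexx.
  by have /andP[/le_trans h /h] := Ax j.
pose rho := emb r *m invmx Z.
have rhoE : rho = emb (a0 - ar).
  apply/rowP => j; apply/eqP; rewrite eq_le.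
  have : shift r (emb a0 - rho).
    rewrite /shift/= subrK; apply: (in0 K' a0 b0) => //.
    by rewrite -shift0; exact: shift_neq0.
  have : K' (emb ar + rho) by exact: (in0 (shift r) ar br (@shift_neq0 r) rE).
  rewrite K'E rE => /(_ j)/andP[+ _] /(_ j)/andP[+ _].
  by rewrite !mxE rmorphB/= => ? ?; apply/andP; split; lra.
have -> : r = (a0 - ar) *m M.
  by apply: (@emb_inj R); rewrite emb_mul -rhoE /rho mulmxKV.
by exists (a + (a0 - ar)); rewrite mulmxDl.
Qed.

(** The closed unit cells at the integer points of the box cover the box thickened
    by the unit cube. *)
Lemma int_box_points (a b : 'rV[int]_n) :
  (leb (minkowski_sum (int_box a b : set 'rV[R]_n) unit_cube) <=
   counting (int_points (int_box a b : set 'rV[R]_n)))%E.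
Proof.
have cB : compact (int_box a b : set 'rV[R]_n).
  have := @rV_compact R n (fun j => `[(a 0 j)%:~R, (b 0 j)%:~R]%classic)
    (fun=> @segment_compact _ _ _).
  by congr compact; apply/funext => v; apply/propext; split=> h j; have := h j;
    rewrite /= in_itv.
have fB := finite_int_points cB.
pose C (w : 'rV[int]_n) : set 'rV[R]_n := [set x | unit_cube (x - emb w)].
have mC w : row_measurable (C w).
  by apply: row_measurable_translate; exact: unit_cube_measurable.
have lC w : leb (C w) = 1%E.
  by rewrite leb_translate ?leb_unit_cube//; exact: unit_cube_measurable.
have := leb_bigcup_le mC (fset_set (int_points (int_box a b : set 'rV[R]_n))).
rewrite fset_setK// (eq_bigr (fun=> (1 : R)%:E)); last by move=> w _; exact: lC.
rewrite sumEFin big_const_seq count_predT iter_addr addr0.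
rewrite countingE//; apply: le_trans; apply: le_leb.
- by apply: compact_row_measurable; exact: compact_cube_sum.
- have := row_measurable_bigcup mC (fset_set (int_points (int_box a b : set 'rV[R]_n))).
  by rewrite fset_setK.
move=> _ [x xab [c c01 <-]].
(* On the upper facets the floor exceeds [b]; the cell below contains the point. *)
pose w : 'rV[int]_n := \row_j Num.min (archimedean.Num.floor ((x + c) 0 j)) (b 0 j).
have fle j : (archimedean.Num.floor ((x + c) 0 j))%:~R <= (x + c) 0 j :> R.
  exact: archimedean.Num.Theory.floor_le.
have flt j : (x + c) 0 j < (archimedean.Num.floor ((x + c) 0 j))%:~R + 1 :> R.
  by have := archimedean.Num.Theory.floorD1_gt ((x + c) 0 j); rewrite rmorphD.
exists w; move=> j; have /andP[ax xb] := xab j; have /andP[c0 c1] := c01 j.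
  rewrite embE mxE; apply/andP; split; last by rewrite ler_int ge_min lexx orbT.
  rewrite ler_int le_min; apply/andP; split; last first.
    by rewrite -(ler_int R) (le_trans ax).
  rewrite archimedean.Num.Theory.floor_ge_int mxE.
  by rewrite -[X in X <= _]addr0 lerD.
have -> : (x + c - emb w) 0 j = (x + c) 0 j - emb w 0 j by rewrite mxE [X in _ + X]mxE.
rewrite [emb w 0 j]embE [w 0 j]mxE; move: (fle j) (flt j).
have -> : (x + c) 0 j = x 0 j + c 0 j by rewrite mxE.
move: (archimedean.Num.floor _) => f.
move: (x 0 j) (c 0 j) ax xb c0 c1 => u v ax xb c0 c1.
case: (leP f (b 0 j)) => [_|]; last rewrite -(ltr_int R).
  by move=> h1 h2; apply/andP; split; lra.
by move=> h1 h2 h3; apply/andP; split; lra.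
Qed.

Theorem equality_coord_converse (a b : 'rV[int]_n) : K' = int_box a b ->
  (forall y : 'rV[int]_n, exists c, y = c *m M) ->
  counting (int_points K) = (`|\det Z|%:E * leb (minkowski_sum K' unit_cube))%E.
Proof.
move=> K'E sM; apply/eqP; rewrite eq_le le_counting_coord/= detZE.
have -> : `|\det M|%N = 1%N.
  have [E EM] : exists E : 'M[int]_n, E *m M = 1%:M.
    exists (\matrix_i projT1 (cid (sM (row i 1%:M)))).
    apply/row_matrixP => i; rewrite row_mul rowK.
    by case: cid => c /= <-.
  have := congr1 (fun B => `|\det B|%N) EM.
  by rewrite det_mulmx det1 abszM => /eqP; rewrite muln_eq1 => /andP[_ /eqP].
rewrite mul1e K'E; apply: le_trans (int_box_points a b) _; rewrite -K'E.
have fK := finite_int_points cK.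
apply: (@counting_image_le R _ _ (fun y => projT1 (cid (sM y)))) => // c Kc.
exists (c *m M); first by rewrite /int_points/= emb_mul.
case: cid => d /= cd.
apply: (@emb_inj R); apply: (can_inj (mulmxK uZ)).
by rewrite -!emb_mul cd.
Qed.

End sublattice.

(** * Faces of parallelepipeds *)

Section parallelepiped_faces.
Context {R : realType} {n : nat}.

Definition para (v : 'rV[R]_n) (W : 'M[R]_n) : set 'rV[R]_n :=
  [set v + c *m W | c in unit_cube].

Lemma paraE v (w : 'I_n -> 'rV[R]_n) :
  minkowski_sum [set v] (segment_sum [set: 'I_n]%SET w) = para v (\matrix_j w j).
Proof.
have D1 (c : 'rV[R]_n) : c *m diag_mx (\row_j (j \in [set: 'I_n]%SET)%:R) = c.
  by apply/rowP => j; rewrite mul_diag_set finset.in_setT.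
rewrite segment_sumE; apply/seteqP; split=> [_ [_ -> [_ [c c01 <-] <-]]|_ [c c01 <-]].
  by exists c => //; rewrite D1.
by exists v => //; exists (c *m \matrix_j w j) => //; exists c; rewrite ?D1.
Qed.

Lemma segmentP (a b x : 'rV[R]_n) :
  segment a b x <-> exists2 t, 0 <= t <= 1 & x = a + t *: (b - a).
Proof.
have E t : (1 - t) *: a + t *: b = a + t *: (b - a).
  by rewrite scalerBl scale1r scalerBr addrAC addrA.
split=> [[t /= + <-]|[t t01 ->]]; first by rewrite in_itv/= => t01; exists t.
by exists t; rewrite /= ?in_itv.
Qed.

Variables (v : 'rV[R]_n) (W : 'M[R]_n).
Hypothesis uW : W \in unitmx.

Lemma para_inj (c d : 'rV[R]_n) : v + c *m W = v + d *m W -> c = d.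
Proof. by move=> /addrI /(can_inj (mulmxK uW)). Qed.

Lemma scale_row_eq0 (a : R) k : a *: row k W = 0 -> a = 0.
Proof.
rewrite rowE scalemxAl -(mul0mx 1 W) => /(can_inj (mulmxK uW))/rowP/(_ k).
by rewrite !mxE !eqxx mulr1.
Qed.

Lemma cube_pushP (c : 'rV[R]_n) k (e : R) : unit_cube c ->
  0 <= c 0 k + e <= 1 -> unit_cube (c + e *: delta_mx 0 k).
Proof.
move=> c01 ce j; rewrite !mxE eqxx/=; have [->|_] := eqVneq j k.
  by rewrite mulr1.
by rewrite mulr0 addr0; exact: c01.
Qed.

(** Through a point strictly inside the range of its [k]-th coordinate, a face
    contains a segment in direction [row k W]. *)
Lemma face_para_push F (c : 'rV[R]_n) k : face (para v W) F -> unit_cube c ->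
  F (v + c *m W) -> 0 < c 0 k < 1 ->
  exists2 e, e != 0 & F (v + c *m W + e *: row k W).
Proof.
move=> [_ _ ext] c01 Fc /andP[c0 c1].
pose e := Num.min (c 0 k) (1 - c 0 k).
have e0 : 0 < e by rewrite lt_min c0 subr_gt0.
have e1 : e <= c 0 k by rewrite ge_min lexx.
have e2 : e <= 1 - c 0 k by rewrite ge_min lexx orbT.
exists e; first by rewrite gt_eqF.
have E d : v + c *m W + d *: row k W = v + (c + d *: delta_mx 0 k) *m W.
  by rewrite mulmxDl -scalemxAl -rowE addrA.
have mem d : 0 <= c 0 k + d <= 1 -> para v W (v + c *m W + d *: row k W).
  by move=> h; rewrite E; exists (c + d *: delta_mx 0 k) => //; exact: cube_pushP.
have [] // := ext (v + c *m W + e *: row k W) (v + c *m W + (- e) *: row k W) (1 / 2).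
- by apply: mem; apply/andP; split; lra.
- by apply: mem; apply/andP; split; lra.
- by apply/andP; split; lra.
have mid (x d : 'rV[R]_n) : (1 - 1 / 2) *: (x + d) + (1 / 2) *: (x - d) = x.
  by apply/rowP => j; rewrite !mxE; field.
by rewrite scaleNr mid.
Qed.

(** A vertex cannot be pushed, so all its coordinates are 0 or 1. *)
Lemma vertex_para x : vertex (para v W) x ->
  exists2 c : 'rV[R]_n, (forall j, c 0 j = 0 \/ c 0 j = 1) & x = v + c *m W.
Proof.
move=> fx; have [sub _ _] := fx; have [c c01 cx] := sub x erefl.
exists c => // j; have /andP[] := c01 j; rewrite le_eqVlt => /orP[/eqP <-|c0]; first by left.
rewrite le_eqVlt => /orP[/eqP ->|c1]; first by right.
have c01j : 0 < c 0 j < 1 by apply/andP.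
have [e e0] := face_para_push fx c01 cx c01j.
by rewrite cx /= -[RHS]addr0 => /addrI/scale_row_eq0 ez; rewrite ez eqxx in e0.
Qed.

(** The midpoint of an edge can be pushed along any coordinate in which the two
    ends differ, and only along the edge. *)
Lemma edge_para x y : edge (para v W) x y -> exists k r, y - x = r *: row k W.
Proof.
move=> [xy fxy]; have [sub _ _] := fxy.
have xs : segment x y x by apply/segmentP; exists 0; rewrite ?lexx ?ler01// scale0r addr0.
have ys : segment x y y.
  by apply/segmentP; exists 1; rewrite ?lexx ?ler01// scale1r addrC subrK.
have [c c01 cx] := sub _ xs; have [d d01 dy] := sub _ ys.
have [k ck] : exists k, c 0 k != d 0 k.
  apply/existsP; apply: contraT; rewrite negb_exists => /forallP cd.
  have cdE : c = d by apply/rowP => j; apply/eqP; have := cd j; rewrite negbK.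
  by rewrite -cx -dy cdE eqxx in xy.
pose m := (1 / 2 : R) *: (c + d).
have m01 : unit_cube m.
  move=> j; rewrite !mxE; have /andP[? ?] := c01 j; have /andP[? ?] := d01 j.
  by apply/andP; split; lra.
have mE : v + m *m W = x + (1 / 2) *: (y - x).
  rewrite -cx -dy opprD addrACA subrr add0r -mulmxBl scalemxAl -addrA -mulmxDl.
  by congr (_ + _ *m _); rewrite /m; apply/rowP => j; rewrite !mxE; field.
have mk : 0 < m 0 k < 1.
  rewrite !mxE; have /andP[? ?] := c01 k; have /andP[? ?] := d01 k.
  by move: ck; rewrite neq_lt => /orP[?|?]; apply/andP; split; lra.
have ms : segment x y (v + m *m W).
  by apply/segmentP; exists (1 / 2) => //; apply/andP; split; lra.
have [e e0 /segmentP[t _]] := face_para_push fxy m01 ms mk.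
rewrite mE -addrA => /addrI tE.
have {}tE : e *: row k W = (t - 1 / 2) *: (y - x).
  by rewrite scalerBl -tE [RHS]addrC addKr.
have t0 : t - 1 / 2 != 0.
  apply: contra e0 => /eqP t0; move: tE; rewrite t0 scale0r => tE.
  by apply/eqP; apply: scale_row_eq0 tE.
exists k, (e / (t - 1 / 2)).
by rewrite mulrC -scalerA tE scalerA mulVf// scale1r.
Qed.

(** 0 and 1 are extreme points of the unit interval, so fixing coordinates to such
    values cuts out a face. *)
Lemma para_subface (I : {set 'I_n}) (u : 'rV[R]_n) :
  (forall j, j \in I -> u 0 j = 0 \/ u 0 j = 1) ->
  face (para v W) [set v + c *m W | c in [set c | unit_cube c /\
     forall j, j \in I -> c 0 j = u 0 j]].
Proof.
move=> u01.
have comb (c d : 'rV[R]_n) t : (1 - t) *: (v + c *m W) + t *: (v + d *m W) =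
    v + ((1 - t) *: c + t *: d) *m W.
  by rewrite !scalerDr addrACA -scalerDl subrK scale1r mulmxDl -!scalemxAl.
split.
- by move=> _ [c [c01 _] <-]; exists c.
- apply/convex_setP => _ _ t t0 t1 [c [c01 cu] <-] [d [d01 du] <-]; rewrite comb.
  exists ((1 - t) *: c + t *: d) => //; split=> j.
    rewrite !mxE; have /andP[? ?] := c01 j; have /andP[? ?] := d01 j.
    by apply/andP; split; nra.
  by move=> jI; rewrite !mxE cu// du// -mulrDl subrK mul1r.
move=> _ _ t [c c01 <-] [d d01 <-] /andP[t0 t1]; rewrite comb => -[m [_ mu]] /para_inj mE.
have cdu j : j \in I -> c 0 j = u 0 j /\ d 0 j = u 0 j.
  move=> jI; have := mu j jI; rewrite mE !mxE.
  have /andP[? ?] := c01 j; have /andP[? ?] := d01 j.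
  by case: (u01 j jI) => -> h; split; nra.
by split; [exists c|exists d] => //; split=> // j /cdu [].
Qed.

Lemma para_vertex (u : 'rV[R]_n) : (forall j, u 0 j = 0 \/ u 0 j = 1) ->
  vertex (para v W) (v + u *m W).
Proof.
move=> u01; have := @para_subface [set: 'I_n]%SET u (fun j _ => u01 j).
congr face; apply/seteqP; split=> [_ [c [_ cu] <-]|_ ->].
  by congr (_ + _ *m _); apply/rowP => j; rewrite cu// finset.in_setT.
by exists u => //; split=> // j; case: (u01 j) => ->; rewrite ?lexx ?ler01.
Qed.

Lemma para_edge k : edge (para v W) v (v + row k W).
Proof.
split.
  apply/eqP => h; have : 1 *: row k W = 0.
    by apply: (addrI v); rewrite scale1r addr0 -h.
  by move=> /scale_row_eq0/eqP; rewrite oner_eq0.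
have := @para_subface (~: [set k])%SET 0 (fun j _ => or_introl (mxE _ _ _ _)).
congr face; apply/seteqP; split=> [_ [c [c01 cu] <-]|x /segmentP[t t01 ->]].
  apply/segmentP; exists (c 0 k) => //; rewrite [v + row k W]addrC addrK; congr (_ + _).
  rewrite rowE scalemxAl; congr (_ *m _); apply/rowP => j; rewrite !mxE eqxx/=.
  have [->|jk] := eqVneq j k; first by rewrite mulr1.
  by rewrite mulr0 cu ?mxE// finset.in_setC finset.in_set1.
exists (t *: delta_mx 0 k); last first.
  by rewrite -scalemxAl -rowE [v + row k W]addrC addrK.
split=> j; rewrite !mxE eqxx/=; first by case: eqP => _; rewrite ?mulr1// mulr0 lexx ler01.
by rewrite finset.in_setC finset.in_set1 => /negbTE ->; rewrite mulr0.
Qed.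

End parallelepiped_faces.

(** * Parallelepipeds with edges along the lattice basis *)

Section parallelepiped_class.
Context {R : realType}.
Variables (n : nat) (M : 'M[int]_n) (K : set 'rV[R]_n).
Local Notation Z := (map_mx (fun x : int => x%:~R : R) M).
Hypothesis uZ : Z \in unitmx.

Let K' : set 'rV[R]_n := [set t | K (t *m Z)].

Lemma KE x : K x <-> K' (x *m invmx Z).
Proof. by rewrite /K'/= mulmxKV. Qed.

(** An interior point of [K] can be moved along each [row j Z] within [K]. *)
Lemma int_box_interior (a b : 'rV[int]_n) : interior K !=set0 ->
  K' = int_box a b -> forall j, (a 0 j)%:~R < (b 0 j)%:~R :> R.
Proof.
move=> [x0 /nbhs_ballP[e /= e0 eK]] K'E j.
pose h : R := 1 + \sum_i `|Z j i|.
have h0 : 0 < h by rewrite ltr_pwDl// sumr_ge0.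
pose s := e / h.
have s0 : 0 < s by rewrite divr_gt0.
have Kx0 : K x0 by apply: eK; exact: ballxx.
have Kx1 : K (x0 + s *: row j Z).
  apply: eK; apply/(mx_ballP _ _ e0) => i.
  rewrite mxE opprD addrA subrr add0r normrN mxE normrM gtr0_norm//.
  rewrite /s mulrAC ltr_pdivrMr// ltr_pM2l// mxE.
  rewrite /h (bigD1 i)//= addrCA ltrDl ltr_pwDl// sumr_ge0//.
have := KE x0; have := KE (x0 + s *: row j Z).
rewrite K'E => -[/(_ Kx1)/(_ j)/andP[_ +] _] [/(_ Kx0)/(_ j)/andP[+ _] _].
rewrite mulmxDl -scalemxAl rowE mulmxK// !mxE !eqxx mulr1 => ? ?.
by move: s0 => ?; lra.
Qed.

Lemma segment_sum_para (z : 'I_n -> 'rV[R]_n) :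
  segment_sum [set: 'I_n]%SET z = para 0 (\matrix_j z j).
Proof.
rewrite -paraE; apply/seteqP; split=> [x Px|_ [_ -> [x Px <-]]]; last by rewrite add0r.
by exists 0 => //; exists x => //; rewrite add0r.
Qed.

Lemma int_box_para (a b : 'rV[int]_n) :
  (forall j, (a 0 j)%:~R < (b 0 j)%:~R :> R) -> K' = int_box a b ->
  K = para (emb a *m Z) (diag_mx (emb (b - a)) *m Z).
Proof.
move=> ab K'E; apply/seteqP; split=> [x /KE|_ [c c01 <-]].
  rewrite K'E => xab; set t := x *m invmx Z in xab.
  exists (\row_j ((t 0 j - (a 0 j)%:~R) / (b 0 j - a 0 j)%:~R)).
    move=> j; rewrite mxE; have /andP[h1 h2] := xab j.
    have h3 : 0 < (b 0 j - a 0 j)%:~R :> R by rewrite rmorphB/= subr_gt0.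
    apply/andP; split; first by apply: divr_ge0; [rewrite subr_ge0|exact: ltW].
    by rewrite ler_pdivrMr// mul1r rmorphB/=; lra.
  rewrite mulmxA -mulmxDl -[RHS](mulmxKV uZ) -/t; congr (_ *m _).
  apply/rowP => j; rewrite mxE mul_mx_diag !mxE.
  have h3 : (b 0 j - a 0 j)%:~R != 0 :> R by rewrite rmorphB/= gt_eqF// subr_gt0.
  by rewrite divfK// addrC subrK.
apply/KE; rewrite mulmxA -mulmxDl mulmxK// K'E => j.
rewrite mxE mul_mx_diag !mxE rmorphB/=; have /andP[c0 c1] := c01 j; have := ab j.
by move=> h; apply/andP; split; nra.
Qed.

Theorem int_box_in_class (z : 'I_n -> 'rV[R]_n) (a b : 'rV[int]_n) :
  \matrix_j z j = Z -> interior K !=set0 -> K' = int_box a b ->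
  lattice_parallelepipeds_along (segment_sum [set: 'I_n]%SET z) K.
Proof.
move=> zZ Kint K'E; have ab := int_box_interior Kint K'E.
have KP := int_box_para ab K'E; set W := diag_mx _ *m Z in KP.
have uW : W \in unitmx.
  rewrite unitmx_mul uZ andbT unitmxE det_diag unitfE; apply/prodf_neq0 => j _.
  by rewrite embE mxE [X in _ + X]mxE rmorphB/= gt_eqF// subr_gt0.
have rW k : row k W = (b 0 k - a 0 k)%:~R *: row k Z.
  by rewrite /W row_mul row_diag_mx -scalemxAl -rowE embE !mxE.
rewrite segment_sum_para zZ; split.
- exists (emb a *m Z), (fun k => row k W).
  have rWE : \matrix_k row k W = W by apply/row_matrixP => k; rewrite rowK.
  by rewrite paraE rWE row_free_unit.
- move=> x; rewrite KP => /(vertex_para uW)[c c01 ->].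
  exists ((a + \row_j if c 0 j == 0 then 0 else (b 0 j - a 0 j)) *m M) => //.
  rewrite -/(emb _) emb_mul embD /W mulmxA -mulmxDl; congr ((_ + _) *m _).
  apply/rowP => j; rewrite embE mul_mx_diag !mxE.
  have [->|c0] := eqVneq (c 0 j) 0; first by rewrite mul0r.
  by have [/eqP|->] := c01 j; [rewrite (negbTE c0)|rewrite mul1r].
move=> x y; rewrite KP => /(edge_para uW)[k [r ->]].
exists 0, (0 + row k Z); split; first exact: para_edge.
exists (r * (b 0 k - a 0 k)%:~R).
by rewrite subr0 add0r rW scalerA.
Qed.

(** The edges of [K] at the vertex [v] are the rows of [W]. Each is a multiple
    [rho k] of some row [sg k] of [Z], and [sg] is injective because the rows of
    [W] are independent. Since [v] and [v + row k W] are lattice points, [rho k]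
    is an integer, so [K] is an integer box in the coordinates of [Z]. *)
Theorem class_int_box (z : 'I_n -> 'rV[R]_n) :
  \matrix_j z j = Z -> (forall y : 'rV[int]_n, exists c, y = c *m M) ->
  lattice_parallelepipeds_along (segment_sum [set: 'I_n]%SET z) K ->
  exists a b, K' = int_box a b.
Proof.
move=> zZ sM [[v [w [fw KP]]] vert edges].
move: KP; rewrite paraE; set W := \matrix_j w j => KP.
have uW : W \in unitmx by rewrite -row_free_unit.
have latt x : integer_lattice x -> exists a : 'rV[int]_n, x = emb a *m Z.
  by move=> [y _ <-]; have [a ->] := sM y; exists a; rewrite -emb_mul.
have [al vE] : exists a : 'rV[int]_n, v = emb a *m Z.
  apply: latt; apply: vert; rewrite KP.
  have := @para_vertex R n v W uW 0 (fun j => or_introl (mxE _ _ _ _)).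
  by rewrite mul0mx addr0.
have vw k : exists a : 'rV[int]_n, v + row k W = emb a *m Z.
  apply: latt; apply: vert; rewrite KP rowE.
  by apply: para_vertex => // j; rewrite mxE eqxx/=; case: eqP => _; [right|left].
have dir k : exists p : 'I_n * R, row k W = p.2 *: row p.1 Z.
  have : edge K v (v + row k W) by rewrite KP; exact: para_edge.
  move=> /edges[c [d [ecd [r]]]]; rewrite addrC addKr => ->.
  move: ecd; rewrite segment_sum_para zZ => /(edge_para uZ)[l [r' ->]].
  by exists (l, r * r'); rewrite scalerA.
pose sg k := (projT1 (cid (dir k))).1; pose rho k := (projT1 (cid (dir k))).2.
have rW k : row k W = rho k *: row (sg k) Z by rewrite /rho /sg; case: cid.
have rho0 k : rho k != 0.
  apply/eqP => rk; have := rW k; rewrite rk scale0r -[LHS]scale1r.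
  by move=> /(scale_row_eq0 uW)/eqP; rewrite oner_eq0.
have sg_inj : injective sg.
  move=> k l kl; apply/eqP; apply: contraT => nkl.
  have : (rho l *: delta_mx 0 k - rho k *: delta_mx 0 l : 'rV[R]_n) *m W = 0 *m W.
    by rewrite mulmxBl -!scalemxAl -!rowE !rW kl !scalerA mulrC subrr mul0mx.
  move=> /(can_inj (mulmxK uW))/rowP/(_ k).
  rewrite !mxE !eqxx (negbTE nkl)/= mulr1 mulr0 subr0 => /eqP.
  by rewrite (negbTE (rho0 l)).
pose s := perm sg_inj.
have rhoZ k : exists m : int, rho k = m%:~R.
  have [be] := vw k; rewrite vE rW rowE scalemxAl -mulmxDl => /(can_inj (mulmxK uZ)).
  move=> /rowP/(_ (sg k)); rewrite !mxE !eqxx mulr1 => h.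
  by exists (be 0 (sg k) - al 0 (sg k)); rewrite rmorphB/= -h [RHS]addrC addKr.
pose m k := projT1 (cid (rhoZ k)).
have mE k : rho k = (m k)%:~R by rewrite /m; case: cid.
have m0 k : (m k)%:~R != 0 :> R by rewrite -mE.
have cW (c : 'rV[R]_n) :
    v + c *m W = (emb al + \row_j (c 0 ((s^-1)%g j) * (m ((s^-1)%g j))%:~R)) *m Z.
  rewrite mulmxDl -vE; congr (_ + _); rewrite !mulmx_sum_row.
  rewrite [RHS](reindex_inj (@perm_inj _ s))/=; apply: eq_bigr => k _.
  by rewrite rW mxE permK permE scalerA mE.
(* The edge belonging to the coordinate [j] is [(s^-1) j]; its factor may be
   negative, in which case [al] gives the upper end. *)
exists (al + \row_j Num.min 0 (m ((s^-1)%g j))), (al + \row_j Num.max 0 (m ((s^-1)%g j))).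
have K'P t : K' t <-> exists2 c, unit_cube c &
    t = emb al + \row_j (c 0 ((s^-1)%g j) * (m ((s^-1)%g j))%:~R).
  rewrite /K'/= KP; split=> [[c c01]|[c c01 ->]]; last by exists c => //; rewrite cW.
  by rewrite cW => /(can_inj (mulmxK uZ)) <-; exists c.
apply/seteqP; split=> [t /K'P[c c01 ->] j|t tab].
  rewrite !mxE !rmorphD/=; have /andP[c0 c1] := c01 ((s^-1)%g j).
  case: (leP 0 (m ((s^-1)%g j))) => [|/ltW]; rewrite -(ler_int R) => h;
    by apply/andP; split; nra.
apply/K'P; exists (\row_k ((t 0 (s k) - (al 0 (s k))%:~R) / (m k)%:~R)).
  move=> k; rewrite mxE; have := tab (s k); rewrite !mxE permK !rmorphD/=.
  have := m0 k; case: (ltgtP 0 (m k)) => [mk _|mk _|<-]; last by rewrite eqxx.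
    rewrite addr0 => /andP[h1 h2]; apply/andP; split.
      by apply: divr_ge0; [rewrite subr_ge0|rewrite ler0z ltW].
    by rewrite ler_pdivrMr ?ltr0z// mul1r; lra.
  rewrite addr0 => /andP[h1 h2]; apply/andP; split.
    by rewrite ler_ndivlMr ?ltrz0// mul0r subr_le0.
  by rewrite ler_ndivrMr ?ltrz0// mul1r; lra.
apply/rowP => j; rewrite !mxE permKV divfK ?m0//.
by rewrite addrC subrK.
Qed.

End parallelepiped_class.

(** * The lattice point inequality *)

Lemma lattice_basisP (R : realType) (n : nat) (z : 'I_n -> 'rV[R]_n) (M : 'M[int]_n) :
  row_free (\matrix_j z j) -> \matrix_j z j = map_mx (fun x : int => x%:~R) M ->
  lattice_basis z <-> forall y : 'rV[int]_n, exists a, y = a *m M.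
Proof.
move=> fz zM.
have comb (c : 'I_n -> int) : \sum_j z j *~ c j = emb ((\row_j c j) *m M).
  rewrite emb_mul -zM mulmx_sum_rows; apply: eq_bigr => j _.
  by rewrite embE mxE scaler_int.
split=> [[_ latE] y|sM].
  have : integer_lattice (emb y : 'rV[R]_n) by exists y.
  rewrite latE => -[c _]; rewrite comb => /emb_inj <-.
  by exists (\row_j c j).
split=> //; apply/seteqP; split=> [_ [y _ <-]|_ [c _ <-]].
  have [a ->] := sM y; exists (fun j => a 0 j) => //.
  by rewrite comb -/(emb _); congr (emb (_ *m _)); apply/rowP => j; rewrite mxE.
by rewrite comb; exists ((\row_j c j) *m M).
Qed.

Theorem lemma1p1 (R : realType) (n : nat) (K : set 'rV[R]_n)
    (z : 'I_n -> 'rV[R]_n)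
    (hK : convex_body K)
    (hz : forall j, integer_lattice (z j))
    (hfree : row_free (\matrix_j z j)) :
  let P := segment_sum [set: 'I_n]%SET z in
  let bound := (\sum_(i < n.+1) \sum_(J : {set 'I_n} | #|J| == i)
    vol (n - i) (orth_compl (lin_hull J z))
      (orth_proj (orth_compl (lin_hull J z)) K) *
    vol i (lin_hull J z) (segment_sum J z))%E in
  (lattice_count K <= bound)%E /\
  (lattice_count K = bound <->
    lattice_basis z /\ lattice_parallelepipeds_along P K).
Proof.
move=> P bound; have [cK /convex_setP vK Kint] := hK.
have K0 : K !=set0 by have [x /interior_subset Kx] := Kint; exists x.
pose M : 'M[int]_n := \matrix_j projT1 (cid2 (hz j)).
have zM : \matrix_j z j = map_mx (fun x : int => x%:~R) M.
  by apply/row_matrixP => j; rewrite -map_row !rowK; case: cid2.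
have uZ : map_mx (fun x : int => x%:~R : R) M \in unitmx by rewrite -zM -row_free_unit.
rewrite /bound bound_eq_leb// lattice_countE// zM.
split; first exact: le_counting_coord.
split=> [/(equality_coord cK uZ vK K0)[[a [b KE]] sM]|[/(lattice_basisP hfree zM) sM KP]].
  split; first exact/(lattice_basisP hfree zM).
  exact: int_box_in_class KE.
have [a [b KE]] := class_int_box uZ zM sM KP.
exact: equality_coord_converse KE sM.
Qed.
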